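(* Let $M$ be a smooth manifold with a Riemannian metric $g$ and an affine connection $D$. The natural almost Hermitian structure $(J^D,\widetilde g^D)$ on $TM$ induced by $(g,D)$ is almost Kähler if and only if its Kähler form $\Omega=\widetilde g^D(J^D\cdot,\cdot)$ coincides with the pull-back $\varphi_g^*(\Omega^* )$ of the canonical symplectic form $\Omega^*$ on $T^*M$, where $\varphi_g:TM\to T^*M$ is the natural isomorphism defined by $\varphi_g(X)=g(X,\cdot)$ for $X\in TM$.
   Context: Let $(x^1,\dots,x^n)$ be local coordinates on $M$, $(x^i,y^i)$ the induced coordinates on $TM$ with $y^j(\xi)=\xi^j$ for $\xi=\sum_i\xi^i\frac{\partial}{\partial x^i}$, and $D_{\partial/\partial x^i}\frac{\partial}{\partial x^j}=\sum_k\Gamma^k_{ij}\frac{\partial}{\partial x^k}$. For $X=\sum_iX^i\frac{\partial}{\partial x^i},\ \xi\in T_xM$, the horizontal and vertical lifts of $X$ at $\xi$ are $$X^H_\xi=\sum_i X^i\frac{\partial}{\partial x^i}-\sum_{i,j,k}\Gamma^k_{ij}X^iy^j(\xi)\frac{\partial}{\partial y^k},\qquad X^V_\xi=\sum_i X^i\frac{\partial}{\partial y^i}.$$ The natural almost Hermitian structure $(J^D,\widetilde g^D)$ is defined by $J^DX^H_\xi=X^V_\xi$, $J^DX^V_\xi=-X^H_\xi$, $\widetilde g^D(X^H_\xi,Y^H_\xi)=\widetilde g^D(X^V_\xi,Y^V_\xi)=g(X,Y)$, $\widetilde g^D(X^H_\xi,Y^V_\xi)=0$ for $X,Y,\xi\in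 T_xM$. An almost Hermitian structure is almost Kähler if its Kähler form is closed. On $T^*M$, with local coordinates $(x^1,\dots,x^n,z_1,\dots,z_n)$ where $z_i(\psi)=\psi_i$ for $\psi=\sum_i\psi_idx^i$, the canonical symplectic form is locally $\Omega^*=\sum_i dx^i\wedge dz_i$, with the convention $(\alpha\wedge\beta)(A,B)=\alpha(A)\beta(B)-\alpha(B)\beta(A)$. *)

(* Defs.v *)
(* Charts are pairs of total functions, meaningful on their domains.  An atlas
   selects a preferred chart [chart_at p] around each point p, and T_pM is the
   model space E itself: a vector is stored as its components in [chart_at p].
   Components in any other chart are obtained from the differential of the
   transition map ([tcoord], with inverse [tvec]). *)
From HB Require Import structures.
From mathcomp Require Import all_boot all_order all_algebra.
From mathcomp Require Import all_classical all_reals topology normedtype derive.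

Set Implicit Arguments.
Unset Strict Implicit.
Unset Printing Implicit Defensive.

Import Order.TTheory GRing.Theory Num.Theory.
Import numFieldNormedType.Exports.

Local Open Scope classical_set_scope.
Local Open Scope ring_scope.

Section Smooth.
Context {R : realType} {V W : normedModType R}.

(* For finite-dimensional V and open U this is the usual class C^k. *)
Fixpoint Ck_on (k : nat) (U : set V) (f : V -> W) : Prop :=
  match k with
  | 0 => forall x, U x -> {for x, continuous f}
  | k.+1 => (forall x, U x -> differentiable f x) /\
            (forall v, Ck_on k U (fun x => 'd f x v))
  end.

Definition smooth_on (U : set V) (f : V -> W) : Prop := forall k, Ck_on k U f.

End Smooth.

Record atlas (R : realType) (T : Type) (E : normedModType R) := Atlas {
  chart : Type;
  dom : chart -> set T;
  coord : chart -> T -> E;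
  param : chart -> E -> T;
  chart_at : T -> chart }.

Arguments chart {R T E} _.
Arguments dom {R T E} A c _ : rename.
Arguments coord {R T E} A c p : rename.
Arguments param {R T E} A c x : rename.
Arguments chart_at {R T E} A p : rename.

Section AtlasTheory.
Context {R : realType} {T : Type} {E : normedModType R}.
Variable A : atlas T E.

Definition im (c : chart A) : set E := coord A c @` dom A c.

Definition tcoord (c : chart A) (p : T) (v : E) : E :=
  'd (coord A c \o param A (chart_at A p)) (coord A (chart_at A p) p) v.

Definition tvec (c : chart A) (p : T) (a : E) : E :=
  'd (coord A (chart_at A p) \o param A c) (coord A c p) a.

Definition smooth_fun_on (U : set T) (f : T -> R) : Prop :=
  forall c, smooth_on (coord A c @` (dom A c `&` U)) (f \o param A c).

Definition smooth_field_on (U : set T) (X : T -> E) : Prop :=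
  forall c, smooth_on (coord A c @` (dom A c `&` U))
    (fun x => tcoord c (param A c x) (X (param A c x))).

Definition dir_deriv (f : T -> R) (p : T) (v : E) : R :=
  'd (f \o param A (chart_at A p)) (coord A (chart_at A p) p) v.

Definition bilin_in_chart (w : T -> E -> E -> R) (c : chart A) (u v : E)
    (x : E) : R :=
  w (param A c x) (tvec c (param A c x) u) (tvec c (param A c x) v).

(* The fields with constant components u, v, z in a chart commute, so the
   bracket terms of the invariant formula for the exterior derivative drop. *)
Definition ext_deriv_in_chart (w : T -> E -> E -> R) (c : chart A)
    (u v z : E) (x : E) : R :=
  'd (bilin_in_chart w c v z) x u - 'd (bilin_in_chart w c u z) x v
  + 'd (bilin_in_chart w c u v) x z.

Definition closed_form (w : T -> E -> E -> R) : Prop :=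
  forall c x, im c x -> forall u v z, ext_deriv_in_chart w c u v z x = 0.

Record is_riemannian (g : T -> E -> E -> R) : Prop := IsRiemannian {
  riem_linear : forall p a u v w,
    g p (a *: u + v) w = a * g p u w + g p v w;
  riem_sym : forall p u v, g p u v = g p v u;
  riem_pos : forall p u, u != 0 -> 0 < g p u u;
  riem_smooth : forall c u v, smooth_on (im c) (bilin_in_chart g c u v) }.

Record is_almost_complex (J : T -> E -> E) : Prop := IsAlmostComplex {
  acs_linear : forall p a u v, J p (a *: u + v) = a *: J p u + J p v;
  acs_sqr : forall p u, J p (J p u) = - u;
  acs_smooth : forall c u, smooth_on (im c)
    (fun x => tcoord c (param A c x)
                (J (param A c x) (tvec c (param A c x) u))) }.

Record is_almost_hermitian (J : T -> E -> E) (h : T -> E -> E -> R) : Prop :=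
  IsAlmostHermitian {
    ah_complex : is_almost_complex J;
    ah_metric : is_riemannian h;
    ah_compat : forall p u v, h p (J p u) (J p v) = h p u v }.

Definition kahler_form (J : T -> E -> E) (h : T -> E -> E -> R) :
  T -> E -> E -> R := fun p u v => h p (J p u) v.

Definition is_almost_kahler (J : T -> E -> E) (h : T -> E -> E -> R) : Prop :=
  is_almost_hermitian J h /\ closed_form (kahler_form J h).

End AtlasTheory.

Section Pullback.
Context {R : realType} {T T' : Type} {E E' : normedModType R}.
Variables (A : atlas T E) (A' : atlas T' E') (phi : T -> T').

Definition tangent_map (p : T) (v : E) : E' :=
  'd (coord A' (chart_at A' (phi p)) \o phi \o param A (chart_at A p))
     (coord A (chart_at A p) p) v.

Definition pullback (w : T' -> E' -> E' -> R) : T -> E -> E -> R :=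
  fun p u v => w (phi p) (tangent_map p u) (tangent_map p v).

End Pullback.

Record is_smooth_atlas (R : realType) (T : topologicalType)
    (E : normedModType R) (A : atlas T E) : Prop := IsSmoothAtlas {
  dom_open : forall c, open (dom A c);
  im_open : forall c : chart A, open (im c);
  chart_at_dom : forall p, dom A (chart_at A p) p;
  coordK : forall c p, dom A c p -> param A c (coord A c p) = p;
  coord_continuous : forall c p, dom A c p -> {for p, continuous (coord A c)};
  param_continuous : forall (c : chart A) x, im c x -> {for x, continuous (param A c)};
  transition_smooth : forall c c',
    smooth_on (coord A c @` (dom A c `&` dom A c'))
              (coord A c' \o param A c) }.

Record manifold (R : realType) (n : nat) := Manifold {
  mfd_sort :> topologicalType;
  mfd_atlas : atlas mfd_sort 'rV[R]_n;
  mfd_smooth : is_smooth_atlas mfd_atlas;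
  mfd_hausdorff : hausdorff_space mfd_sort;
  mfd_second_countable : @second_countable mfd_sort }.

Section Bundles.
Context {R : realType} {n : nat}.
Local Notation E := 'rV[R]_n.
Variable M : manifold R n.
Local Notation A := (mfd_atlas M).

Record riemannian_metric := RiemannianMetric {
  metric :> M -> E -> E -> R;
  metricP : is_riemannian A metric }.

(* Local vector fields are total functions M -> E with irrelevant values off
   their domain, and the connection acts on them: the axioms hold at p as soon
   as the arguments are smooth on an open neighbourhood U of p.  Scaling by the
   indicator function of U, which is smooth on U, shows that conn X Y p depends
   only on the germs of X and Y at p, so this is the usual notion of connection
   together with its restrictions to open subsets. *)
Record affine_connection := AffineConnection {
  conn :> (M -> E) -> (M -> E) -> M -> E;
  conn_smooth : forall (U : set M) X Y, open U ->
    smooth_field_on A U X -> smooth_field_on A U Y ->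
    smooth_field_on A U (conn X Y);
  conn_linear : forall (U : set M) f X X' Y, open U -> smooth_fun_on A U f ->
    smooth_field_on A U X -> smooth_field_on A U X' ->
    smooth_field_on A U Y -> forall p, U p ->
    conn (fun q => f q *: X q + X' q) Y p = f p *: conn X Y p + conn X' Y p;
  conn_add : forall (U : set M) X Y Y', open U ->
    smooth_field_on A U X -> smooth_field_on A U Y ->
    smooth_field_on A U Y' -> forall p, U p ->
    conn X (fun q => Y q + Y' q) p = conn X Y p + conn X Y' p;
  conn_leibniz : forall (U : set M) f X Y, open U -> smooth_fun_on A U f ->
    smooth_field_on A U X -> smooth_field_on A U Y -> forall p, U p ->
    conn X (fun q => f q *: Y q) p
    = dir_deriv A f p (X p) *: Y p + f p *: conn X Y p }.

(* the local field d/dx^i of the chart c *)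
Definition coord_field (c : chart A) (i : 'I_n) : M -> E :=
  fun p => tvec c p (delta_mx 0 i).

(* the k-th entry of this row is Gamma^k_ij at p, in the chart c *)
Definition christoffel (D : affine_connection) (c : chart A) (p : M)
    (i j : 'I_n) : E :=
  tcoord c p (D (coord_field c i) (coord_field c j) p).

(* TM: the pair (p, v) is the vector v of T_pM; the chart induced by c is
   (x^i, y^i), so a tangent vector at (p, v) is a pair of rows, the components
   on d/dx^i and on d/dy^i, for c the preferred chart at p. *)
Definition TM : Type := (M * E)%type.

Definition tangent_atlas : atlas TM (E * E)%type := {|
  chart := chart A;
  dom := fun c => [set xi : TM | dom A c xi.1];
  coord := fun c xi => (coord A c xi.1, tcoord c xi.1 xi.2);
  param := fun c z => (param A c z.1, tvec c (param A c z.1) z.2);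
  chart_at := fun xi => chart_at A xi.1 |}.

(* The lifts are given by the same formula in every chart around the base point;
   it is written here in the preferred one, in which X : T_pM and xi.2 are
   their own components. *)
Definition conn_term (D : affine_connection) (xi : TM) (X : E) : E :=
  \sum_i \sum_j (X 0 i * xi.2 0 j) *:
    christoffel D (chart_at A xi.1) xi.1 i j.

Definition hlift (D : affine_connection) (xi : TM) (X : E) : E * E :=
  (X, - conn_term D xi X).

Definition vlift (xi : TM) (X : E) : E * E := (0, X).

(* [hor B] and [ver D xi B] are the unique vectors of T_pM such that
   B = hlift D xi (hor B) + vlift xi (ver D xi B) (lemma [lift_decomp]). *)
Definition hor (B : E * E) : E := B.1.
Definition ver (D : affine_connection) (xi : TM) (B : E * E) : E :=
  B.2 + conn_term D xi B.1.

Definition nat_J (D : affine_connection) : TM -> E * E -> E * E :=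
  fun xi B => vlift xi (hor B) - hlift D xi (ver D xi B).

Definition nat_metric (g : riemannian_metric) (D : affine_connection) :
    TM -> E * E -> E * E -> R :=
  fun xi B C => g xi.1 (hor B) (hor C) + g xi.1 (ver D xi B) (ver D xi C).

(* T*M: the pair (p, psi) is the linear form psi on T_pM. *)
Definition CTM : Type := (M * {linear E -> R^o})%type.

Definition mk_covector (f : E -> R^o) (Hf : linear f) : {linear E -> R^o} :=
  HB.pack f (GRing.isLinear.Build R E R^o *:%R f Hf).

Fact covector_in_chart_linear (c : chart A) (p : M) (z : E) :
  linear ((fun v => \sum_i z 0 i * tcoord c p v 0 i) : E -> R^o).
Proof.
move=> a u v; rewrite /tcoord scaler_sumr -big_split /=.
by apply: eq_bigr => i _; rewrite linearP !mxE mulrDr mulrCA.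
Qed.

(* sum_i z_i dx^i at p, in the chart c *)
Definition covector_in_chart (c : chart A) (p : M) (z : E) :
  {linear E -> R^o} := mk_covector (covector_in_chart_linear c p z).

Definition cotangent_atlas : atlas CTM (E * E)%type := {|
  chart := chart A;
  dom := fun c => [set psi : CTM | dom A c psi.1];
  coord := fun c psi =>
    (coord A c psi.1, \row_i psi.2 (coord_field c i psi.1));
  param := fun c z => (param A c z.1, covector_in_chart c (param A c z.1) z.2);
  chart_at := fun psi => chart_at A psi.1 |}.

(* sum_i dx^i /\ dz_i in the coordinates of the preferred chart *)
Definition canonical_symplectic : CTM -> E * E -> E * E -> R :=
  fun psi B C => \sum_i (B.1 0 i * C.2 0 i - C.1 0 i * B.2 0 i).

Fact metric_linear (g : riemannian_metric) (p : M) (X : E) :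
  linear (g p X : E -> R^o).
Proof.
move=> a u v; have [glin gsym _ _] := metricP g.
by rewrite gsym glin !(gsym p _ X).
Qed.

Definition flat (g : riemannian_metric) : TM -> CTM :=
  fun xi => (xi.1, mk_covector (metric_linear g xi.1 xi.2)).

Section NaturalStructure.
Variables (g : riemannian_metric) (D : affine_connection) (xi : TM).

Lemma hor_hlift X : hor (hlift D xi X) = X. Proof. by []. Qed.

Lemma ver_hlift X : ver D xi (hlift D xi X) = 0.
Proof. by rewrite /ver addNr. Qed.

Lemma hor_vlift X : hor (vlift xi X) = 0. Proof. by []. Qed.

Lemma conn_term0 : conn_term D xi 0 = 0.
Proof.
by rewrite /conn_term big1 // => i _; rewrite big1 // => j _;
   rewrite mxE mul0r scale0r.
Qed.

Lemma ver_vlift X : ver D xi (vlift xi X) = X.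
Proof. by rewrite /ver conn_term0 addr0. Qed.

Lemma lift_decomp B : B = hlift D xi (hor B) + vlift xi (ver D xi B).
Proof.
by case: B => b c; congr pair; rewrite /= ?addr0 // /ver /= addrC addrK.
Qed.

Lemma hlift0 : hlift D xi 0 = 0.
Proof. by rewrite /hlift conn_term0 oppr0. Qed.

Lemma nat_J_hlift X : nat_J D xi (hlift D xi X) = vlift xi X.
Proof. by rewrite /nat_J hor_hlift ver_hlift hlift0 subr0. Qed.

Lemma nat_J_vlift X : nat_J D xi (vlift xi X) = - hlift D xi X.
Proof.
have vlift0 : vlift xi 0 = 0 by [].
by rewrite /nat_J hor_vlift ver_vlift vlift0 sub0r.
Qed.

Lemma metric0l (p : M) X : g p 0 X = 0.
Proof.
have [glin _ _ _] := metricP g.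
by have := glin p (-1) 0 0 X; rewrite scaler0 addr0 mulN1r addNr.
Qed.

Lemma metric0r (p : M) X : g p X 0 = 0.
Proof. by have [_ gsym _ _] := metricP g; rewrite gsym metric0l. Qed.

Lemma nat_metric_hh X Y :
  nat_metric g D xi (hlift D xi X) (hlift D xi Y) = g xi.1 X Y.
Proof. by rewrite /nat_metric !hor_hlift !ver_hlift metric0l addr0. Qed.

Lemma nat_metric_vv X Y :
  nat_metric g D xi (vlift xi X) (vlift xi Y) = g xi.1 X Y.
Proof. by rewrite /nat_metric !hor_vlift !ver_vlift metric0l add0r. Qed.

Lemma nat_metric_hv X Y :
  nat_metric g D xi (hlift D xi X) (vlift xi Y) = 0.
Proof.
by rewrite /nat_metric hor_vlift ver_hlift metric0r metric0l addr0.
Qed.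

End NaturalStructure.
End Bundles.

(* Main.v *)
(* In the chart of TM induced by a chart of M, write z = (x, y) for a point and
   u = (u1, u2) for a tangent vector.  There the Kaehler form is
     g_x(u1, v2 + Gamma(v1, y)) - g_x(u2 + Gamma(u1, y), v1),
   and the pull-back of the canonical form is, up to sign, the differential of
   the Liouville form z |-> g_x(y, .), hence closed by the symmetry of second
   derivatives.  In their difference the terms in u2 and v2 cancel: it is a
   2-form in u1 and v1 alone, with coefficients linear in y.  If it is closed,
   evaluating its exterior derivative on u, v and the vertical vector (0, y)
   leaves only its derivative along (0, y), which by linearity is its value at
   z; so it vanishes.  Since the structures are defined pointwise in preferred
   charts, these formulas rest on the transformation law of the Christoffel
   symbols and on the invariance of the Liouville form. *)
Require Import Defs.
From HB Require Import structures.
From mathcomp Require Import all_boot all_order all_algebra.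
From mathcomp Require Import all_classical all_reals topology normedtype landau
  derive.
Set Implicit Arguments.
Unset Strict Implicit.
Unset Printing Implicit Defensive.

Import Order.TTheory GRing.Theory Num.Theory.
Import numFieldNormedType.Exports.
(* Otherwise [coord] would be that of [vector]. *)
Import Defs.

Local Open Scope classical_set_scope.
Local Open Scope ring_scope.

(** * Smooth maps *)

(** The obstacle is that preferred charts may jump from point to point, so a form or a field given
    by its preferred components cannot be differentiated as it stands. Each one is first rewritten
    by a formula valid over the whole domain of one fixed chart, and differentials are carried over
    by equality near a point. Such formulas exist because the second derivatives of the transition
    maps drop out: in the vertical part they are absorbed by the inhomogeneous term in the law of
    the Christoffel symbols, in the canonical form they cancel by symmetry. The difference of the
    two forms has a meaning: it is the torsion of the connection dual to [D] with respect to [g],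
    paired through [g] with the point [y] of the fibre. This explains why it is linear in [y] and
    does not see vertical vectors. For the converse, closedness of the pull-back suffices, because
    the natural structure is almost Hermitian for every [g] and [D]. *)

Section NearEqual.
Context {R : numFieldType} {V W : normedModType R}.
Implicit Types (f g : V -> W) (x : V).

Let near_eq_expansion f g x : {near x, f =1 g} -> differentiable f x ->
  g \o shift x = cst (g x) + 'd f x +o_ 0 id.
Proof.
move=> fg df; apply/eqaddoP => e e0; have /eqaddoP /(_ e e0) := diff_locally df.
have fg0 : \forall h \near 0, f (h + x) = g (h + x).
  by move: fg; rewrite (near_shift 0) subr0.
apply: filterS2 fg0 => h; rewrite !fctE /= => <-.
by rewrite -(nbhs_singleton fg).
Qed.

(** A differential depends only on the germ: [g] inherits the first-order expansion of [f], and such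
    an expansion is unique. *)
Lemma near_eq_diff f g x : {near x, f =1 g} -> differentiable f x ->
  'd g x = 'd f x :> (V -> W).
Proof.
move=> fg df; apply: diff_unique; first exact: diff_continuous.
exact: near_eq_expansion.
Qed.

Lemma near_eq_differentiable f g x : {near x, f =1 g} -> differentiable f x ->
  differentiable g x.
Proof.
move=> fg df; apply/diff_locallyP; rewrite (near_eq_diff fg df).
by split; [exact: diff_continuous | exact: near_eq_expansion].
Qed.
End NearEqual.

(** * Closure properties of maps of class C^k *)

Section CkOn.
Context {R : realType}.
Implicit Types (V W : normedModType R).

Lemma diff_compE V V' W (f : V -> V') (g : V' -> W) x v :
  differentiable f x -> differentiable g (f x) ->
  'd (g \o f) x v = 'd g (f x) ('d f x v).
Proof. by move=> df dg; rewrite (diff_comp df dg). Qed.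

Lemma near_eq_diffE V W (f g : V -> W) x v : {near x, f =1 g} ->
  differentiable f x -> 'd g x v = 'd f x v.
Proof. by move=> fg df; rewrite (near_eq_diff fg df). Qed.

Lemma diff_cstE V W (w : W) (x v : V) : 'd (fun _ => w) x v = 0.
Proof. by rewrite diff_cst. Qed.

Lemma diff_linE V W (l : {linear V -> W}) x v : continuous l ->
  'd l x v = l v.
Proof. by move=> cl; rewrite diff_lin. Qed.

Lemma open_near V (U : set V) (x : V) (P : V -> Prop) : open U -> U x ->
  (forall y, U y -> P y) -> \forall y \near x, P y.
Proof. by move=> oU Ux UP; apply: filterS UP _; exact: open_nbhs_nbhs. Qed.

(** Openness turns equality on [U] into equality near each of its points; this passes to the
    differentials, so the induction can go on. *)
Lemma Ck_on_eq V W k (U : set V) (f g : V -> W) : open U ->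
  (forall x, U x -> f x = g x) -> Ck_on k U f -> Ck_on k U g.
Proof.
move=> oU; elim: k f g => [|k IH] f g fg /=.
  move=> cf x Ux; have := cf x Ux; rewrite /prop_for /continuous_at (fg _ Ux).
  apply: cvg_trans; apply: near_eq_cvg.
  by apply: open_near Ux _ => // y /fg.
move=> [df Cf]; split=> [x Ux|v].
  by apply: near_eq_differentiable (df x Ux); exact: open_near Ux fg.
apply: IH (Cf v) => x Ux; apply/esym.
by rewrite (near_eq_diff _ (df x Ux))//; exact: open_near Ux fg.
Qed.

Lemma Ck_on_sub V W k (U U' : set V) (f : V -> W) : U' `<=` U ->
  Ck_on k U f -> Ck_on k U' f.
Proof.
move=> UU; elim: k f => [|k IH] f /=; first by move=> cf x /UU; exact: cf.
by move=> [df Cf]; split=> [x /UU|v]; [exact: df | exact/IH/Cf].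
Qed.

(** Serves the product and chain rules, where the factor that is not differentiated must give up one
    order of regularity. *)
Lemma Ck_onW V W k (U : set V) (f : V -> W) : Ck_on k.+1 U f -> Ck_on k U f.
Proof.
elim: k f => [|k IH] f [df Cf].
  by move=> x Ux; exact/differentiable_continuous/df.
by split=> // v; exact/IH/Cf.
Qed.

Lemma Ck_on_cst V W k (U : set V) (w : W) : Ck_on k U (fun _ => w).
Proof.
elim: k w => [|k IH] w /=; first by move=> x _; exact: cst_continuous.
split=> [x _|v]; first exact: differentiable_cst.
rewrite [X in Ck_on _ _ X](_ : _ = fun _ => 0) //.
by apply/funext => x; rewrite diff_cst.
Qed.

Lemma Ck_on_add V W k (U : set V) (f g : V -> W) : open U ->
  Ck_on k U f -> Ck_on k U g -> Ck_on k U (fun x => f x + g x).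
Proof.
move=> oU; elim: k f g => [|k IH] f g /=.
  by move=> cf cg x Ux; apply: continuousD; [exact: cf|exact: cg].
move=> [df Cf] [dg Cg]; split=> [x Ux|v].
  by apply: differentiableD; [exact: df|exact: dg].
apply: Ck_on_eq (IH _ _ (Cf v) (Cg v)) => // x Ux.
by rewrite diffD //; [exact: df|exact: dg].
Qed.

Lemma Ck_on_lin V W W' k (U : set V) (l : {linear W -> W'}) (f : V -> W) :
  open U -> continuous l -> Ck_on k U f -> Ck_on k U (fun x => l (f x)).
Proof.
move=> oU cl; elim: k f => [|k IH] f /=.
  by move=> cf x Ux; apply: continuous_comp; [exact: cf|exact: cl].
move=> [df Cf]; split=> [x Ux|v].
  by apply: differentiable_comp; [exact: df|exact: linear_differentiable].
apply: Ck_on_eq (IH _ (Cf v)) => // x Ux.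
rewrite (diff_comp (df x Ux)) ?diff_lin //; exact: linear_differentiable.
Qed.

Lemma Ck_on_linear V W k (U : set V) (l : {linear V -> W}) :
  continuous l -> Ck_on k U l.
Proof.
move=> cl; case: k => [|k]; first by move=> x _; exact: cl.
split=> [x Ux|v]; first exact: linear_differentiable.
rewrite [X in Ck_on _ _ X](_ : _ = fun _ => l v); first exact: Ck_on_cst.
by apply/funext => x; rewrite diff_lin.
Qed.

Lemma Ck_on_pair V W W' k (U : set V) (f : V -> W) (g : V -> W') : open U ->
  Ck_on k U f -> Ck_on k U g -> Ck_on k U (fun x => (f x, g x)).
Proof.
move=> oU; elim: k f g => [|k IH] f g /=.
  by move=> cf cg x Ux; apply: cvg_pair; [exact: cf|exact: cg].
move=> [df Cf] [dg Cg]; split=> [x Ux|v].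
  by apply: differentiable_pair; [exact: df|exact: dg].
apply: Ck_on_eq (IH _ _ (Cf v) (Cg v)) => // x Ux.
by rewrite diff_pair //; [exact: df|exact: dg].
Qed.

Lemma scale_is_bilinear W : bilinear_for
  (GRing.Scale.Law.clone _ _ *:%R _) (GRing.Scale.Law.clone _ _ *:%R _)
  (@GRing.scale R W).
Proof.
split=> [u'|u] a x y /=; first by rewrite scalerDl scalerA.
by rewrite scalerDr !scalerA mulrC.
Qed.

(** The Leibniz rule, as the chain rule for [y |-> (f y, g y)] followed by the continuous bilinear
    map [B]. *)
Lemma is_diff_scale V W (f : V -> R) (g : V -> W) x :
  differentiable f x -> differentiable g x ->
  is_diff x (fun y => f y *: g y) (fun v => f x *: 'd g x v + 'd f x v *: g x).
Proof.
move=> df dg.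
pose B : {bilinear R -> W -> W} := HB.pack (@GRing.scale R W)
  (bilinear_isBilinear.Build R R W W _ _ (@GRing.scale R W)
    (@scale_is_bilinear W)).
have Bc : continuous (fun p : R * W => B p.1 p.2).
  by move=> p; apply: scale_continuous.
have dB := @differentiable_bilin _ _ _ _ B (f x, g x) Bc.
have dfg : differentiable (fun y => (f y, g y)) x by exact: differentiable_pair.
split; first exact: (differentiable_comp dfg dB).
have := diff_comp dfg dB; rewrite diff_pair// (diff_bilin _ Bc).
exact.
Qed.

Lemma Ck_on_scale V W k (U : set V) (f : V -> R) (g : V -> W) : open U ->
  Ck_on k U f -> Ck_on k U g -> Ck_on k U (fun x => f x *: g x).
Proof.
move=> oU; elim: k f g => [|k IH] f g Cf Cg.
  by move=> x Ux; apply: continuousZ; [exact: Cf|exact: Cg].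
have [df Df] := Cf; have [dg Dg] := Cg; split=> [x Ux|v].
  by have [] := is_diff_scale (df x Ux) (dg x Ux).
refine (Ck_on_eq oU _ (Ck_on_add oU (IH _ _ (Ck_onW Cf) (Dg v))
  (IH _ _ (Df v) (Ck_onW Cg)))) => x Ux.
by have [_ ->] := is_diff_scale (df x Ux) (dg x Ux).
Qed.

Lemma Ck_on_sum V W k (U : set V) (I : Type) (r : seq I) (f : I -> V -> W) :
  open U -> (forall i, Ck_on k U (f i)) ->
  Ck_on k U (fun x => \sum_(i <- r) f i x).
Proof.
move=> oU Cf; elim: r => [|i r IH].
  apply: (Ck_on_eq _ _ (Ck_on_cst k U 0)) => // x _; by rewrite big_nil.
by apply: Ck_on_eq (Ck_on_add oU (Cf i) IH) => // x _; rewrite big_cons.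
Qed.

End CkOn.

(* [e] and [c] are dual bases of the finite-dimensional space [V]. *)
Record frame (R : realType) (V : normedModType R) := Frame {
  frame_idx : finType;
  frame_vec : frame_idx -> V;
  frame_coord : frame_idx -> {linear V -> R};
  frame_continuous : forall i, continuous (frame_coord i);
  frameE : forall v, v = \sum_i frame_coord i v *: frame_vec i }.

(** * Frames, the chain rule in class C^k, and smooth maps *)

Section Frames.
Context {R : realType}.
Implicit Types (V W : normedModType R).

Lemma linear_row_coord n (i : 'I_n) : linear (fun v : 'rV[R]_n => v 0 i : R).
Proof. by move=> a u v; rewrite !mxE. Qed.

Definition row_coord n (i : 'I_n) : {linear 'rV[R]_n -> R} :=
  HB.pack (fun v : 'rV[R]_n => v 0 i : R)
    (GRing.isLinear.Build _ _ _ _ _ (linear_row_coord i)).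

Lemma row_coord_continuous n (i : 'I_n) : continuous (row_coord i).
Proof. exact: matrix_normedtype.coord_continuous. Qed.

Lemma diff_entry V n (f : V -> 'rV[R]_n) (i : 'I_n) x v : differentiable f x ->
  'd (fun y => f y 0 i : R) x v = 'd f x v 0 i.
Proof.
move=> df; apply: (etrans (diff_compE v df (differentiable_coord _ _ _))).
exact: (diff_linE (l := row_coord i) _ _ (@row_coord_continuous _ i)).
Qed.

Definition row_frame n : frame 'rV[R]_n :=
  Frame (@row_coord_continuous n) (@row_sum_delta _ n).

Lemma fst_continuous V W : continuous (fst : V * W -> V).
Proof. move=> x; exact: cvg_fst. Qed.

Lemma snd_continuous V W : continuous (snd : V * W -> W).
Proof. move=> x; exact: cvg_snd. Qed.

(** Induced charts of [TM] take values in [E * E], and maps with vector arguments live on larger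
    products; the chain rule [Ck_on_comp] needs a frame of each. *)
Definition pair_frame V W (bV : frame V) (bW : frame W) : frame (V * W)%type.
Proof.
pose e (i : frame_idx bV + frame_idx bW) : V * W :=
  match i with inl i => (frame_vec i, 0) | inr i => (0, frame_vec i) end.
pose c (i : frame_idx bV + frame_idx bW) : {linear (V * W)%type -> R} :=
  match i with
  | inl i => (frame_coord i \o fst)%FUN | inr i =>
    (frame_coord i \o snd)%FUN end.
apply: (@Frame _ _ _ e c) => [[] i x|[v w]].
- by apply: continuous_comp; [exact: fst_continuous|exact: frame_continuous].
- by apply: continuous_comp; [exact: snd_continuous|exact: frame_continuous].
have sum_pair (I : finType) (x : I -> V) (y : I -> W) :
    \sum_i (x i, y i) = (\sum_i x i, \sum_i y i).
  apply: injective_projections; rewrite /=.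
    exact: (raddf_sum fst).
  exact: (raddf_sum snd).
rewrite big_sumType /= [in LHS](frameE bV v) [in LHS](frameE bW w).
have Ev : \sum_(i : frame_idx bV) frame_coord i v *: (frame_vec i, 0 : W) =
    (\sum_(i : frame_idx bV) frame_coord i v *: frame_vec i, 0).
  by rewrite sum_pair; congr pair; rewrite big1 // => i _; rewrite scaler0.
have Ew : \sum_(i : frame_idx bW) frame_coord i w *: (0 : V, frame_vec i) =
    (0, \sum_(i : frame_idx bW) frame_coord i w *: frame_vec i).
  by rewrite sum_pair; congr pair; rewrite big1 // => i _; rewrite scaler0.
rewrite [X in X + _]Ev [X in _ + X]Ew.
by apply: injective_projections; rewrite /= ?addr0 ?add0r.
Defined.

(* By [frameE], the differential of [g \o f] is a combination of the partial
   derivatives of [g], composed with [f], with coefficients the components of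
   the differential of [f]. *)
Lemma Ck_on_comp V V' W k (b : frame V') (U : set V) (U' : set V')
    (f : V -> V') (g : V' -> W) : open U -> open U' ->
  (forall x, U x -> U' (f x)) ->
  Ck_on k U f -> Ck_on k U' g -> Ck_on k U (g \o f).
Proof.
move=> oU oU' fU; elim: k g => [|k IH] g Cf Cg.
  by move=> x Ux; apply: continuous_comp; [exact: Cf|exact/Cg/fU].
have [df Df] := Cf; have [dg Dg] := Cg; split=> [x Ux|v].
  by apply: differentiable_comp; [exact: df|exact/dg/fU].
refine (Ck_on_eq oU _ (Ck_on_sum (index_enum (frame_idx b)) oU (fun i =>
  Ck_on_scale oU (Ck_on_lin oU (@frame_continuous _ _ b i) (Df v))
    (IH _ (Ck_onW Cf) (Dg (frame_vec i)))))) => x Ux.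
rewrite (diff_comp (df x Ux) (dg _ (fU x Ux))) /= [in RHS](frameE b
  ('d f x v)) linear_sum.
by apply: eq_bigr => i _; rewrite linearZ.
Qed.


Lemma smooth_on_eq V W (U : set V) (f g : V -> W) : open U ->
  (forall x, U x -> f x = g x) -> smooth_on U f -> smooth_on U g.
Proof. by move=> oU fg sf k; exact: Ck_on_eq fg (sf k). Qed.

Lemma smooth_on_sub V W (U U' : set V) (f : V -> W) : U' `<=` U ->
  smooth_on U f -> smooth_on U' f.
Proof. by move=> UU sf k; exact: Ck_on_sub UU (sf k). Qed.

Lemma smooth_on_cst V W (U : set V) (w : W) : smooth_on U (fun _ => w).
Proof. by move=> k; exact: Ck_on_cst. Qed.

Lemma smooth_on_add V W (U : set V) (f g : V -> W) : open U ->
  smooth_on U f -> smooth_on U g -> smooth_on U (fun x => f x + g x).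
Proof. by move=> oU sf sg k; exact: Ck_on_add. Qed.

Lemma smooth_on_lin V W W' (U : set V) (l : {linear W -> W'}) (f : V -> W) :
  open U -> continuous l -> smooth_on U f -> smooth_on U (fun x => l (f x)).
Proof. by move=> oU cl sf k; exact: Ck_on_lin. Qed.

Lemma smooth_on_linear V W (U : set V) (l : {linear V -> W}) :
  continuous l -> smooth_on U l.
Proof. by move=> cl k; exact: Ck_on_linear. Qed.

Lemma smooth_on_pair V W W' (U : set V) (f : V -> W) (g : V -> W') : open U ->
  smooth_on U f -> smooth_on U g -> smooth_on U (fun x => (f x, g x)).
Proof. by move=> oU sf sg k; exact: Ck_on_pair. Qed.

Lemma smooth_on_scale V W (U : set V) (f : V -> R) (g : V -> W) : open U ->
  smooth_on U f -> smooth_on U g -> smooth_on U (fun x => f x *: g x).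
Proof. by move=> oU sf sg k; exact: Ck_on_scale. Qed.

Lemma smooth_on_opp V W (U : set V) (f : V -> W) : open U ->
  smooth_on U f -> smooth_on U (fun x => - f x).
Proof.
move=> oU sf; have := smooth_on_scale oU (@smooth_on_cst V R U (-1)) sf.
by apply: smooth_on_eq => // x _; rewrite scaleN1r.
Qed.

Lemma smooth_on_sum V W (U : set V) (I : Type) (r : seq I) (f : I -> V -> W) :
  open U -> (forall i, smooth_on U (f i)) ->
  smooth_on U (fun x => \sum_(i <- r) f i x).
Proof. by move=> oU sf k; apply: Ck_on_sum => // i; exact: sf. Qed.

Lemma smooth_on_comp V V' W (b : frame V') (U : set V) (U' : set V')
    (f : V -> V') (g : V' -> W) : open U -> open U' ->
  (forall x, U x -> U' (f x)) ->
  smooth_on U f -> smooth_on U' g -> smooth_on U (g \o f).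
Proof. by move=> oU oU' fU sf sg k; exact: Ck_on_comp fU (sf k) (sg k). Qed.

Lemma smooth_on_diff V W (U : set V) (f : V -> W) v : smooth_on U f ->
  smooth_on U (fun x => 'd f x v).
Proof. by move=> sf k; have [_] := sf k.+1; exact. Qed.

Lemma smooth_on_differentiable V W (U : set V) (f : V -> W) x : smooth_on U f ->
  U x -> differentiable f x.
Proof. by move=> sf; have [+ _] := sf 1%N; exact. Qed.

Lemma is_diff_sum V W (I : Type) (r : seq I) (f : I -> V -> W) x :
  (forall i, differentiable (f i) x) ->
  is_diff x (fun y => \sum_(i <- r) f i y) (fun v =>
    \sum_(i <- r) 'd (f i) x v).
Proof.
move=> df; elim: r => [|i r IH].
  rewrite (_ : (fun y => _) = cst 0); last first.
    by apply/funext => y; rewrite big_nil.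
  apply: is_diff_eq.
  by apply/funext => y; rewrite big_nil.
rewrite (_ : (fun y => _) = f i + (fun y => \sum_(i <- r) f i y)); last first.
  by apply/funext => y; rewrite big_cons.
have [dS dSE] := is_diffD (differentiableP (df i)) IH.
by split=> //; rewrite dSE; apply/funext => y; rewrite big_cons.
Qed.

(** * Maps linear in one argument *)

Section LinearParameter.
Context {V V' W : normedModType R} (bV : frame V) (bV' : frame V').
Variables (O : set V) (F : V -> V' -> W).
Hypotheses (openO : open O) (Flin : forall x, linear (F x))
  (Fsmooth : forall v, smooth_on O (F ^~ v)).

Let FE x v : F x v =
  \sum_(i : frame_idx bV') frame_coord i v *: F x (frame_vec i).
Proof.
pose Fx : {linear V' -> W} :=
  HB.pack (F x) (GRing.isLinear.Build _ _ _ _ _ (@Flin x)).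
rewrite [in LHS](frameE bV' v) -[LHS]/(Fx _) linear_sum.
by apply: eq_bigr => i _; rewrite linearZ.
Qed.

Lemma open_fst : open [set z : V * V' | O z.1].
Proof. by apply: open_comp openO => z _; exact: fst_continuous. Qed.

Let partial_smooth (i : frame_idx bV') :
  smooth_on [set z : V * V' | O z.1] (fun z => F z.1 (frame_vec i)).
Proof.
apply: (smooth_on_comp bV open_fst openO _ _ (Fsmooth _)) => //.
by apply: smooth_on_linear; exact: fst_continuous.
Qed.

Let coord_continuous (i : frame_idx bV') :
  continuous (frame_coord i \o (snd : V * V' -> V'))%FUN.
Proof.
move=> z.
by apply: continuous_comp; [exact: snd_continuous|exact: frame_continuous].
Qed.

Let coord_smooth (i : frame_idx bV') :
  smooth_on [set z : V * V' | O z.1] (fun z => frame_coord i z.2).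
Proof.
apply: (@smooth_on_linear _ _ _ (frame_coord i \o snd)%FUN).
exact: coord_continuous.
Qed.

(** Expanding the second argument in a frame ([FE]) gives a finite sum of coordinates times maps of
    [x] alone, so smoothness for each fixed [v] yields joint smoothness. *)
Lemma smooth_on_linear_param :
  smooth_on [set z : V * V' | O z.1] (fun z => F z.1 z.2).
Proof.
have oO := open_fst.
apply: (smooth_on_eq oO (fun z _ => esym (FE z.1 z.2))).
apply: smooth_on_sum => // i; exact: smooth_on_scale.
Qed.

(** The product rule for each term of the expansion [FE]: differentiating the coefficients
    [F x (frame_vec i)] gives the first summand, differentiating the coordinates of [v] the
    second. *)
Lemma diff_linear_param (z u : V * V') : O z.1 ->
  'd (fun z => F z.1 z.2) z u = 'd (F ^~ z.2) (z.1) u.1 + F z.1 u.2.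
Proof.
move=> Oz.
have dp (i : frame_idx bV') : differentiable (fun z => F z.1 (frame_vec i)) z.
  exact: smooth_on_differentiable (partial_smooth i) _.
have dc (i : frame_idx bV') : differentiable (fun z : V * V' =>
  frame_coord i z.2) z.
  exact: smooth_on_differentiable (coord_smooth i) _.
have dF (i : frame_idx bV') : differentiable (F ^~ (frame_vec i)) (z.1).
  exact: smooth_on_differentiable (Fsmooth _) _.
rewrite (_ : (fun z => F z.1 z.2) = fun z => \sum_(i : frame_idx bV')
  frame_coord i z.2 *: F z.1 (frame_vec i)); last by apply/funext.
(* The coordinates, now constant, are written with [cst] so that [is_diff_scale] covers this side
   too; the extra term contains the differential of a constant and vanishes. *)
rewrite (_ : (F ^~ z.2) = fun x => \sum_(i : frame_idx bV')
  (cst (frame_coord i z.2) x : R) *: F x (frame_vec i)); last by apply/funext.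
have := @is_diff_sum _ _ _ (index_enum (frame_idx bV')) _ z
  (fun i => @ex_diff _ _ _ _ _ _ _ (is_diff_scale (dc i) (dp i))).
move=> [_ ->].
have := @is_diff_sum _ _ _ (index_enum (frame_idx bV')) _ z.1
  (fun i => @ex_diff _ _ _ _ _ _ _ (is_diff_scale
     (differentiable_cst (frame_coord i z.2) z.1) (dF i))).
move=> [_ ->].
rewrite (FE z.1 u.2) -big_split; apply: eq_bigr => i _ /=.
have [_ ->] := is_diff_scale (dc i) (dp i).
have [_ ->] := is_diff_scale (differentiable_cst (frame_coord i z.2) z.1)
  (dF i).
rewrite diff_cst scale0r addr0; congr (_ *: _ + _ *: _).
  rewrite -[X in 'd X _ _]/((F ^~ (frame_vec i)) \o fst) diff_comp //=.
    by rewrite diff_lin //; exact: fst_continuous.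
  by apply: linear_differentiable; exact: fst_continuous.
have := @diff_lin _ _ _ (frame_coord i \o snd)%FUN z (@coord_continuous i).
by move=> /(congr1 (fun h : V * V' -> R => h u)).
Qed.

Lemma diff_param_linear (x w : V) : O x -> linear (fun v => 'd (F ^~ v) x w).
Proof.
move=> Ox a u v.
have dF v' : differentiable (F ^~ v') x by exact: smooth_on_differentiable Ox.
rewrite (_ : F ^~ (a *: u + v) = a *: (F ^~ u) + (F ^~ v)); last first.
  by apply/funext => y; rewrite Flin.
have daF : differentiable (a *: (F ^~ u)) x by exact: differentiableZ.
have -> : 'd (a *: (F ^~ u) + F ^~ v) x w =
    'd (a *: (F ^~ u)) x w + 'd (F ^~ v) x w by rewrite (diffD daF (dF v)).
by rewrite (diffZ a (dF u)).
Qed.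

End LinearParameter.

Arguments open_fst {V V'} {O} openO : rename.

(** [smooth_on_linear_param] is applied twice: to [B] as linear in its first vector with parameter
    [x], then as linear in the second with parameter [(x, y1)]. *)
Lemma smooth_on_bilinear_param V0 V V1 V2 W (b : frame V) (b1 : frame V1)
    (b2 : frame V2) (O0 : set V0) (O : set V) (B : V -> V1 -> V2 -> W)
    (x : V0 -> V) (y1 : V0 -> V1) (y2 : V0 -> V2) :
  open O0 -> open O -> (forall z, O0 z -> O (x z)) ->
  (forall x y, linear (B x ^~ y)) -> (forall x y, linear (B x y)) ->
  (forall y1 y2, smooth_on O (fun x => B x y1 y2)) ->
  smooth_on O0 x -> smooth_on O0 y1 -> smooth_on O0 y2 ->
  smooth_on O0 (fun z => B (x z) (y1 z) (y2 z)).
Proof.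
move=> oO0 oO xO Bl Br sB sx s1 s2.
have oO1 := @open_fst V V1 O oO; have oO2 := @open_fst _ V2 _ oO1.
have sB1 y := smooth_on_linear_param b b1 oO (Bl ^~ y) (sB ^~ y).
have sB2 := smooth_on_linear_param (F := fun t : V * V1 => B t.1 t.2)
  (pair_frame b b1) b2 oO1 (fun t => Br t.1 t.2) sB1.
apply: (@smooth_on_comp V0 (V * V1 * V2)%type W
  (pair_frame (pair_frame b b1) b2) _ _ (fun z => ((x z, y1 z), y2 z)) _
  oO0 oO2 _ _ sB2); first by move=> z /xO.
by apply: smooth_on_pair => //; exact: smooth_on_pair.
Qed.

Lemma smooth_on_row V n (U : set V) (f : 'I_n -> V -> R) : open U ->
  (forall i, smooth_on U (f i)) -> smooth_on U (fun x => \row_i f i x).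
Proof.
move=> oU sf; apply: (@smooth_on_eq _ _ U
  (fun x => \sum_i f i x *: (delta_mx 0 i : 'rV[R]_n))) => //.
  move=> x _; rewrite [RHS]row_sum_delta.
  by apply: eq_bigr => i _; rewrite mxE.
apply: smooth_on_sum => // i; apply: smooth_on_scale => //.
exact: smooth_on_cst.
Qed.

End Frames.

(** * Symmetry of second derivatives *)

Section Schwarz.
Context {R : realType} {V : normedModType R}.
Implicit Types (f : V -> R) (x v w : V).

Lemma mean_value f x v (h : R) : 0 < h ->
  (forall t : R, 0 <= t <= h -> differentiable f (t *: v + x)) ->
  exists2 t : R, 0 < t < h & f (h *: v + x) - f x = h * 'd f (t *: v + x) v.
Proof.
move=> h0 df; pose line (t : R) := t *: v + x.
have dline (t : R) : is_diff t line (fun s => s *: v).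
  rewrite /line -[fun _ => _]/((fun s : R => s *: v) + cst x).
  have [d dE] := is_diffD (is_diff_scalel t v) (is_diff_cst x t).
  by split=> //; rewrite dE addr0.
have dfline (t : R) : 0 <= t <= h -> is_diff t (f \o line) (fun s =>
  'd f (line t) (s *: v)).
  move=> /df dft; have [dl dlE] := dline t.
  split; first exact: differentiable_comp.
  by rewrite (diff_comp dl dft) dlE.
have [|||t] := @MVT R (f \o line) (fun t => 'd f (line t) v) 0 h.
- by [].
- move=> t; rewrite in_itv/= => /andP[t0 th].
  have [d dE] := dfline t (introT andP (conj (ltW t0) (ltW th))).
  by split; [exact: diff_derivable|rewrite deriveE// dE scale1r].
- apply: continuous_in_subspaceT => t; rewrite inE/= in_itv/= => th.
  by apply: differentiable_continuous; have [] := dfline t th.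
rewrite in_itv/= => th; rewrite /= /line scale0r add0r subr0 mulrC => E.
by exists t.
Qed.

(** Euler's identity in degree one: along the line [t *: v + x] the function is affine with slope
    [f x], and the chain rule at [t = 0] reads off this slope. *)
Lemma diff_homogeneous f x v : differentiable f x ->
  (forall t : R, f (t *: v + x) = (t + 1) * f x) -> 'd f x v = f x.
Proof.
move=> df fE; pose line (t : R) : V := t *: v + x.
have [d1 d1E] := is_diffD (is_diff_scalel 0 v) (is_diff_cst x (0 : R)).
have l0 : line 0 = x by rewrite /line scale0r add0r.
have df0 : differentiable f (line 0) by rewrite l0.
have := diff_compE (f := line) (1 : R) d1 df0.
rewrite -[X in 'd f _ X]/('d ( *:%R^~ v + cst x) 0 1) d1E l0.
rewrite -[X in 'd f _ X]/(1 *: v + 0) addr0 scale1r => <-.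
rewrite (_ : f \o line = *:%R ^~ (f x) + cst (f x)); last first.
  by apply/funext => t; rewrite /= fE mulrDl mul1r.
have [_ d2E] := is_diffD (is_diff_scalel 0 (f x)) (is_diff_cst (f x) (0 : R)).
by rewrite d2E -[LHS]/(1 *: f x + 0) addr0 scale1r.
Qed.

(** The second difference over the parallelogram at [x] with sides [h *: v] and [h *: w]. Being
    symmetric in [v] and [w], it links the two orders of differentiation. *)
Definition square_diff f x v w (h : R) : R :=
  f (h *: w + (h *: v + x)) - f (h *: v + x) - (f (h *: w + x) - f x).

Lemma square_diffC f x v w h : square_diff f x v w h = square_diff f x w v h.
Proof.
rewrite /square_diff [h *: w + (h *: v + x)]addrCA.
by rewrite !opprB addrACA [RHS]addrACA [- f (h *: v + x) + _]addrC.
Qed.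

Lemma square_mean_value f x v w (h : R) : 0 < h ->
  (forall s t : R, 0 <= s <= h -> 0 <= t <= h ->
    differentiable f (t *: w + (s *: v + x)) /\
    differentiable (fun y => 'd f y v) (t *: w + (s *: v + x))) ->
  exists s t : R, [/\ 0 < s < h, 0 < t < h & square_diff f x v w h =
    h * (h * 'd (fun y => 'd f y v) (t *: w + (s *: v + x)) w)].
Proof.
move=> h0 df; have hh : 0 <= h <= h by rewrite ltW// lexx.
have zh : 0 <= (0 : R) <= h by rewrite lexx ltW.
have df0 (s : R) : 0 <= s <= h -> differentiable f (s *: v + x).
  by move=> sh; have [+ _] := df s 0 sh zh; rewrite scale0r add0r.
pose sh y : V := h *: w + y.
have dsh y : is_diff y sh id.
  rewrite /sh -[fun _ => _]/(cst (h *: w) + id).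
  have [d dE] := is_diffD (is_diff_cst (h *: w) y) (is_diff_id y).
  by split=> //; rewrite dE add0r.
(* The increment of [f] in the direction [w]. Its own increment along [v] is [square_diff]; the mean
   value along [v] leaves an increment of ['d f] along [w], to which the mean value applies
   again. *)
pose phi := (f \o sh) - f.
have dphi (s : R) : 0 <= s <= h -> is_diff (s *: v + x) phi
    (fun u => 'd f (h *: w + (s *: v + x)) u - 'd f (s *: v + x) u).
  move=> sh_; have [dfs _] := df s h sh_ hh; have [d1 d1E] := dsh (s *: v + x).
  have d2 : differentiable (f \o sh) (s *: v + x) by exact: differentiable_comp.
  have dfs0 := df0 s sh_.
  split; first exact: (differentiableB d2 dfs0).
  have dcE := diff_comp d1 dfs; rewrite d1E in dcE.
  apply: (etrans (diffB d2 dfs0)); apply/funext => u.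
  by rewrite -[LHS]/('d (f \o sh) (s *: v + x) u - 'd f (s *: v + x) u) dcE.
have [s|s s0h E] := @mean_value phi x v h h0; first by move=> /dphi[].
have s0h' : 0 <= s <= h by case/andP: s0h => ? ?; rewrite !ltW.
have [|t t0h E'] := @mean_value (fun y => 'd f y v) (s *: v + x) w h h0.
  by move=> t th; have [] := df s t s0h' th.
exists s, t; split=> //; rewrite -E'.
by have [_ dE] := dphi s s0h'; rewrite dE in E; rewrite -E.
Qed.

(** One and the same second difference, divided by [h] twice, is a value of [A] at one point near
    [x] and of [B] at another. Continuity of [A] and [B] at [x] then rules out [A x <> B x]. *)
Lemma second_diff_sym f (U : set V) x v w : open U -> Ck_on 2 U f -> U x ->
  'd (fun y => 'd f y v) x w = 'd (fun y => 'd f y w) x v.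
Proof.
move=> oU [df C1] Ux.
have [d1v C0v] := C1 v; have [d1w C0w] := C1 w.
have /= cA := C0v w x Ux; have /= cB := C0w v x Ux.
set A := fun y => 'd (fun z => 'd f z v) y w in cA *.
set B := fun y => 'd (fun z => 'd f z w) y v in cB *.
apply/eqP; rewrite -[_ == _]/(A x == B x); apply/negP => /negP AB.
(* Half the distance: if [A] and [B] stay within [e] of their values at [x] and share a value, then
   [A x] and [B x] lie less than [e + e] apart, which is absurd. *)
pose e := `|A x - B x| / 2.
have e0 : 0 < e by rewrite divr_gt0// normr_gt0 subr_eq0.
have /nbhs_ballP[r /= r0 rP] : \forall y \near x,
    [/\ U y, `|A x - A y| < e & `|B x - B y| < e].
  have nU : \forall y \near x, U y by exact: open_nbhs_nbhs.
  have nA : \forall y \near x, `|A x - A y| < e by move/cvgrPdist_lt : cA;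
  exact.
  have nB : \forall y \near x, `|B x - B y| < e by move/cvgrPdist_lt : cB;
  exact.
  by apply: filterS3 nU nA nB => y; split.
(* The summand [1] keeps [N] positive even if [v] and [w] vanish. Since [h * N = r / 2], the whole
   parallelogram lies in the ball of radius [r]. *)
pose N := `|v| + `|w| + 1; have N0 : 0 < N by rewrite ltr_wpDl// addr_ge0.
pose h := r / 2 / N; have h0 : 0 < h by rewrite !divr_gt0.
have bnd (s t : R) v' w' : `|v'| + `|w'| + 1 = N -> 0 <= s <= h ->
  0 <= t <= h ->
    ball x r (t *: w' + (s *: v' + x)).
  move=> E /andP[s0 sh] /andP[t0 th].
  rewrite -ball_normE /= addrA opprD addrCA subrr addr0 normrN.
  apply: (@le_lt_trans _ _ (h * N)); last first.
    by rewrite /h divfK ?gt_eqF// ltr_pdivrMr// ltr_pMr// ltr1n.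
  rewrite -E mulrDr mulrDr; apply: (le_trans (ler_normD _ _)).
  rewrite !normrZ ger0_norm// ger0_norm// [leLHS]addrC.
  apply: (@le_trans _ _ (h * `|v'| + h * `|w'|)).
    by apply: lerD; apply: ler_wpM2r.
  by rewrite lerDl mulr1 ltW.
(* Only the symmetry of [N], despite its name: [bnd] is used a second time with [v] and [w]
   exchanged. *)
have liouville : `|w| + `|v| + 1 = N by rewrite [X in X + _]addrC.
have [s t sh th|s [t [sh th E]]] := @square_mean_value f x v w h h0.
  by have [Uy _ _] := rP _ (bnd s t v w erefl sh th); split;
  [exact: df|exact: d1v].
have [s' t' sh' th'|s' [t' [sh' th' E']]] := @square_mean_value f x w v h h0.
  by have [Uy _ _] := rP _ (bnd s' t' w v liouville sh' th'); split;
  [exact: df|exact: d1w].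
have lt_le (a : R) : 0 < a < h -> 0 <= a <= h by case/andP=> ? ?; rewrite !ltW.
have [_ /[swap] _ Ap] := rP _ (bnd s t v w erefl (lt_le _ sh) (lt_le _ th)).
have [_ _ Bq] := rP _ (bnd s' t' w v liouville (lt_le _ sh') (lt_le _ th')).
have EAB : A (t *: w + (s *: v + x)) = B (t' *: v + (s' *: w + x)).
  have := E; rewrite square_diffC E' => /(mulfI (lt0r_neq0 h0)).
  by move/(mulfI (lt0r_neq0 h0)).
have : `|A x - B x| < e + e.
  rewrite -[A x - B x](subrKA (A (t *: w + (s *: v + x)))) [in X in _ + X]EAB.
  by rewrite (le_lt_trans (ler_normD _ _))// ltrD// distrC.
by rewrite -splitr ltxx.
Qed.

End Schwarz.

(** * Charts *)

Section Charts.
Context {R : realType} {n : nat}.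
Local Notation E := 'rV[R]_n.
Variable M : manifold R n.
Local Notation A := (mfd_atlas M).
Implicit Types (c : chart A) (p q : M) (U : set M).

Let fE : frame E := row_frame n.

Definition chart_image c U : set E := coord A c @` (dom A c `&` U).
Definition transition c c' : E -> E := coord A c' \o param A c.



Lemma param_coord c p : dom A c p -> param A c (coord A c p) = p.
Proof. exact: (coordK (mfd_smooth M)). Qed.

Lemma dom_chart_at p : dom A (chart_at A p) p.
Proof. exact: (chart_at_dom (mfd_smooth M)). Qed.

Lemma chart_image_coord c U p : dom A c p -> U p ->
  chart_image c U (coord A c p).
Proof. by move=> cp Up; exists p. Qed.

Lemma chart_image_sub c U U' : U `<=` U' ->
  chart_image c U `<=` chart_image c U'.
Proof. by move=> UU x [p [cp /UU Up] <-]; exists p. Qed.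

(** Near the coordinates of [p], continuity of [param] keeps the point in [U], and openness of
    [im c] makes every nearby vector the coordinates of some point. *)
Lemma open_chart_image c U : open U -> open (chart_image c U).
Proof.
move=> oU; rewrite openE => x [p [cp Up] <-].
have imp : im c (coord A c p) by exists p.
have nU : \forall y \near coord A c p, U (param A c y).
  have := param_continuous (mfd_smooth M) imp;
  rewrite /prop_for /continuous_at param_coord//.
  by apply; exact: open_nbhs_nbhs.
have nI : \forall y \near coord A c p, im c y.
  by apply: open_nbhs_nbhs; split=> //; exact: (im_open (mfd_smooth M)).
apply: filterS2 nU nI => y + [q cq qy]; rewrite -qy param_coord// => Uq.
by exists q.
Qed.

Lemma open_dom c : open (dom A c).
Proof. exact: (dom_open (mfd_smooth M)). Qed.

Lemma open_im c : open (im c).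
Proof. exact: (im_open (mfd_smooth M)). Qed.

(** Replaces a claim about vectors near [coord A c p] by one about points of [M], where the
    cancellation laws of charts apply. *)
Lemma near_coord c U p (P : E -> Prop) : open U -> dom A c p -> U p ->
  (forall q, dom A c q -> U q -> P (coord A c q)) ->
  \forall x \near coord A c p, P x.
Proof.
move=> oU cp Up UP.
apply: (@open_near _ _ (chart_image c U));
[exact: open_chart_image|exact: chart_image_coord|].
by move=> _ [q [cq Uq] <-]; exact: UP.
Qed.

Lemma transition_coord c c' p : dom A c p ->
  transition c c' (coord A c p) = coord A c' p.
Proof. by move=> cp; rewrite /transition /= param_coord. Qed.

Lemma smooth_transition c c' : smooth_on (chart_image c (dom A c'))
  (transition c c').
Proof. exact: (transition_smooth (mfd_smooth M)). Qed.

Lemma differentiable_transition c c' p : dom A c p -> dom A c' p ->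
  differentiable (transition c c') (coord A c p).
Proof.
move=> cp cp'; apply: smooth_on_differentiable (smooth_transition c c') _.
exact: chart_image_coord.
Qed.

Definition diff_transition c c' (x v : E) : E := 'd (transition c c') x v.

Lemma diff_transition_linear c c' x : linear (diff_transition c c' x).
Proof. by move=> a u v; rewrite /diff_transition linearP. Qed.

Lemma tvecE c p : tvec c p = diff_transition c (chart_at A p) (coord A c p).
Proof. by []. Qed.

Lemma tcoordE c p :
  tcoord c p = diff_transition (chart_at A p) c (coord A (chart_at A p) p).
Proof. by []. Qed.

Lemma diff_transition_smooth c c' v : smooth_on (chart_image c (dom A c'))
  (diff_transition c c' ^~ v).
Proof. exact: smooth_on_diff (smooth_transition c c'). Qed.

(** The cocycle rule: transition maps compose near the point, and the chain rule does the rest. With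
    the preferred chart as one of the three, it yields all conversions between [tvec] and
    [tcoord]. *)
Lemma diff_transition_comp c c' c'' p v : dom A c p -> dom A c' p ->
  dom A c'' p ->
  diff_transition c' c'' (coord A c' p) (diff_transition c c' (coord A c p) v) =
  diff_transition c c'' (coord A c p) v.
Proof.
move=> cp cp' cp''; rewrite /diff_transition.
have d1 := differentiable_transition cp cp';
have d2 := differentiable_transition cp' cp''.
rewrite -(transition_coord c' cp) in d2 *.
apply: (etrans (esym (diff_compE v d1 d2))).
apply: near_eq_diffE; last exact: differentiable_transition.
apply: (near_coord (open_dom c') cp cp') => q cq cq'.
by rewrite /comp (transition_coord c' cq) (transition_coord c'' cq)
  (transition_coord c'' cq').
Qed.

Lemma diff_transition_id c p v : dom A c p ->
  diff_transition c c (coord A c p) v = v.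
Proof.
move=> cp; have cid : continuous (idfun : E -> E) by move=> x.
apply: etrans (diff_linE (coord A c p) v cid).
apply: near_eq_diffE; last exact: linear_differentiable.
by apply: (near_coord (open_dom c) cp cp) => q cq _;
rewrite (transition_coord c cq).
Qed.

(* Unification is prohibitively slow when it may unfold differentials. *)
Local Opaque diff_transition.

Lemma tcoordK c p v : dom A c p -> tvec c p (tcoord c p v) = v.
Proof.
move=> cp; have cp0 := dom_chart_at p.
by rewrite tvecE tcoordE (diff_transition_comp _ cp0 cp cp0) diff_transition_id.
Qed.

Lemma tcoord_tvec c c' p v : dom A c p -> dom A c' p ->
  tcoord c' p (tvec c p v) = diff_transition c c' (coord A c p) v.
Proof.
by move=> cp cp'; rewrite tvecE tcoordE (diff_transition_comp _ cp
  (dom_chart_at p) cp').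
Qed.

Lemma tvecK c p v : dom A c p -> tcoord c p (tvec c p v) = v.
Proof. by move=> cp; rewrite tcoord_tvec// diff_transition_id. Qed.

Lemma tvec_diff_transition c c' p v : dom A c p -> dom A c' p ->
  tvec c' p (diff_transition c c' (coord A c p) v) = tvec c p v.
Proof.
by move=> cp cp'; rewrite !tvecE (diff_transition_comp _ cp cp'
  (dom_chart_at p)).
Qed.

Lemma smooth_fun_on_coord c U (f : E -> R) : open U -> U `<=` dom A c ->
  smooth_on (chart_image c U) f -> smooth_fun_on A U (f \o coord A c).
Proof.
move=> oU Uc sf c'; rewrite -/(chart_image c' U).
have oI := open_chart_image (c := c') oU.
apply: (smooth_on_comp fE oI (open_chart_image (c := c) oU) _ _ sf).
  move=> _ [q [cq Uq] <-]; rewrite param_coord//.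
  by apply: chart_image_coord => //; exact: Uc.
apply: smooth_on_sub (smooth_transition c' c); exact: chart_image_sub.
Qed.

Definition chart_field c (F : E -> E) : M -> E := fun q =>
  tvec c q (F (coord A c q)).

(** In another chart [c'] the components are [diff_transition c c' x (F x)] at
    [x = transition c' c x']. No preferred chart is left in this expression, so its smoothness
    follows by composition. *)
Lemma smooth_chart_field c U (F : E -> E) : open U -> U `<=` dom A c ->
  smooth_on (chart_image c U) F -> smooth_field_on A U (chart_field c F).
Proof.
move=> oU Uc sF c'; rewrite -/(chart_image c' U).
have oI := open_chart_image (c := c') oU;
have oJ := open_chart_image (c := c) (openI oU (open_dom c')).
have sub1 : chart_image c (U `&` dom A c') `<=` chart_image c (dom A c').
  by apply: chart_image_sub => q [].
have sub2 : chart_image c (U `&` dom A c') `<=` chart_image c U by apply: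
  chart_image_sub => q [].
pose Phi (x : E) := diff_transition c c' x (F x).
have sPhi : smooth_on (chart_image c (U `&` dom A c')) Phi.
  have sD := @smooth_on_linear_param R E E E fE fE (chart_image c (dom A c'))
    (diff_transition c c') (open_chart_image (c :=
      c) (open_dom c')) (diff_transition_linear c c')
        (diff_transition_smooth c c').
  apply: (@smooth_on_comp R E (E * E)%type E (pair_frame fE fE) _ _ (fun x =>
    (x, F x)) _ oJ _ _ _ sD).
  - exact: open_fst (open_chart_image (c := c) (open_dom c')).
  - by move=> x /sub1.
  - apply: smooth_on_pair => //; last exact: smooth_on_sub sF.
    by apply: (@smooth_on_linear _ _ _ _ idfun) => x.
apply: (@smooth_on_eq _ _ _ _ (Phi \o transition c' c)) => //.
  move=> _ [q [cq' Uq] <-]; rewrite /= transition_coord// param_coord//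
    /chart_field.
  by rewrite tcoord_tvec//; exact: Uc.
apply: (smooth_on_comp fE oI oJ _ _ sPhi).
  by move=> _ [q [cq Uq] <-]; rewrite transition_coord//;
  apply: chart_image_coord => //; exact: Uc.
by apply: smooth_on_sub (smooth_transition c' c); exact: chart_image_sub.
Qed.

Lemma dir_deriv_coord c p (f : E -> R) v : dom A c p ->
  differentiable f (coord A c p) ->
  dir_deriv A (f \o coord A c) p v = 'd f (coord A c p) (tcoord c p v).
Proof.
move=> cp df; have cp0 := dom_chart_at p.
rewrite -(transition_coord c cp0) in df *.
exact: (diff_compE v (differentiable_transition cp0 cp) df).
Qed.
End Charts.
Arguments open_im {R n M} c.

(** * Connections in a chart *)

Section Connections.
Context {R : realType} {n : nat}.
Local Notation E := 'rV[R]_n.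
Variables (M : manifold R n) (D : affine_connection M).
Local Notation A := (mfd_atlas M).
Implicit Types (c : chart A) (p q : M) (U : set M) (X Y : M -> E).

Lemma param_chart_image c U (x : E) : chart_image c U x -> U (param A c x).
Proof. by move=> [q [cq Uq] <-]; rewrite param_coord. Qed.

Lemma smooth_field_on_eq U X Y : open U -> (forall q, U q -> X q = Y q) ->
  smooth_field_on A U X -> smooth_field_on A U Y.
Proof.
move=> oU XY sX c; apply: smooth_on_eq (sX c); first exact: open_chart_image.
by move=> x /param_chart_image /XY ->.
Qed.

Lemma smooth_fun_on_cst U (a : R) : smooth_fun_on A U (fun _ => a).
Proof. by move=> c; exact: smooth_on_cst. Qed.

Lemma tcoordZ c p a u : tcoord c p (a *: u) = a *: tcoord c p u.
Proof. by rewrite /tcoord linearZ. Qed.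

Lemma tcoordD c p u v : tcoord c p (u + v) = tcoord c p u + tcoord c p v.
Proof. by rewrite /tcoord linearD. Qed.

Lemma tcoord_sum c p (I : Type) (r : seq I) (u : I -> E) :
  tcoord c p (\sum_(i <- r) u i) = \sum_(i <- r) tcoord c p (u i).
Proof. by rewrite /tcoord linear_sum. Qed.

Lemma tvecZ c p a u : tvec c p (a *: u) = a *: tvec c p u.
Proof. by rewrite /tvec linearZ. Qed.

Lemma tvecD c p u v : tvec c p (u + v) = tvec c p u + tvec c p v.
Proof. by rewrite /tvec linearD. Qed.

Lemma tvec_sum c p (I : Type) (r : seq I) (u : I -> E) :
  tvec c p (\sum_(i <- r) u i) = \sum_(i <- r) tvec c p (u i).
Proof. by rewrite /tvec linear_sum. Qed.

Lemma smooth_field_on0 U : smooth_field_on A U (fun _ => 0).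
Proof.
move=> c; rewrite (_ : (fun x => _) = fun _ => 0); first exact: smooth_on_cst.
by apply/funext => x; rewrite /tcoord linear0.
Qed.

Lemma smooth_field_on_scale U (f : M -> R) X : open U ->
  smooth_fun_on A U f -> smooth_field_on A U X ->
  smooth_field_on A U (fun q => f q *: X q).
Proof.
move=> oU sf sX c; have oI := open_chart_image (c := c) oU.
apply: smooth_on_eq (smooth_on_scale oI (sf c) (sX c)) => // x _.
by rewrite tcoordZ.
Qed.

Lemma smooth_field_on_sum U (I : Type) (r : seq I) (X : I -> M -> E) :
  open U -> (forall i, smooth_field_on A U (X i)) ->
  smooth_field_on A U (fun q => \sum_(i <- r) X i q).
Proof.
move=> oU sX c; have oI := open_chart_image (c := c) oU.
apply: smooth_on_eq (smooth_on_sum r oI (fun i => sX i c)) => // x _.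
by rewrite tcoord_sum.
Qed.

(** With coefficient [1] and two zero fields, linearity says that the value [a] satisfies
    [a = a + a]. *)
Lemma conn0l U Y p : open U -> smooth_field_on A U Y -> U p ->
  D (fun _ => 0) Y p = 0.
Proof.
move=> oU sY Up.
have := conn_linear D oU (smooth_fun_on_cst U 1) (smooth_field_on0 U)
  (smooth_field_on0 U) sY Up.
rewrite (_ : (fun q => _) = fun _ => 0); last first.
  by apply/funext => q; rewrite scaler0 addr0.
by rewrite scale1r => /eqP; rewrite -subr_eq0 opprD addNKr oppr_eq0 => /eqP.
Qed.

Lemma conn0r U X p : open U -> smooth_field_on A U X -> U p ->
  D X (fun _ => 0) p = 0.
Proof.
move=> oU sX Up.
have := conn_add D oU sX (smooth_field_on0 U) (smooth_field_on0 U) Up.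
rewrite (_ : (fun q => _) = fun _ => 0); last first.
  by apply/funext => q; rewrite addr0.
by move=> /eqP; rewrite -subr_eq0 opprD addNKr oppr_eq0 => /eqP.
Qed.

(* The connection is local: multiply the fields by the indicator of [U]. *)
Lemma conn_eq U X X' Y Y' p : open U -> U p ->
  (forall q, U q -> X q = X' q) -> (forall q, U q -> Y q = Y' q) ->
  smooth_field_on A U X -> smooth_field_on A U Y -> D X Y p = D X' Y' p.
Proof.
move=> oU Up XX YY sX sY.
have sX' := smooth_field_on_eq oU XX sX;
have sY' := smooth_field_on_eq oU YY sY.
pose ind q : R := (`[< U q >])%:R.
have indE q : U q -> ind q = 1 by rewrite /ind => Uq; rewrite asboolT.
have sind : smooth_fun_on A U ind.
  move=> c; apply: smooth_on_eq (smooth_on_cst _ (1 : R));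
  first exact: open_chart_image.
  by move=> x /param_chart_image /indE /= ->.
have d0 v : dir_deriv A ind p v = 0.
  rewrite -(diff_cstE (1 : R) (coord A (chart_at A p) p) v).
  apply: near_eq_diffE; last exact: differentiable_cst.
  apply: (near_coord oU (dom_chart_at p) Up) => q cq Uq /=.
  by rewrite param_coord ?indE.
(* After multiplication by [ind], fields that agree on [U] are equal as total functions, so one can
   be rewritten into the other under [D]. *)
have indZ (Z Z' : M -> E) : (forall q, U q -> Z q = Z' q) ->
    (fun q => ind q *: Z q) = (fun q => ind q *: Z' q).
  move=> ZZ; apply/funext => q; rewrite /ind.
  by case: asboolP => [/ZZ ->|]; rewrite ?scale0r.
have locr Z Z' : smooth_field_on A U Z -> smooth_field_on A U Z' ->
    D Z (fun q => ind q *: Z' q) p = D Z Z' p.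
  by move=> sZ sZ'; rewrite (conn_leibniz D oU sind)// d0 scale0r add0r indE
    ?scale1r.
have locl Z Z' : smooth_field_on A U Z -> smooth_field_on A U Z' ->
    D (fun q => ind q *: Z q) Z' p = D Z Z' p.
  move=> sZ sZ'.
  have := conn_linear D oU sind sZ (smooth_field_on0 U) sZ' Up.
  rewrite (conn0l oU)// addr0 indE// scale1r => <-; congr (D _ _ _).
  by apply/funext => q; rewrite addr0.
by rewrite -(locl X Y)// (indZ X X' XX) locl// -(locr X' Y)//
  (indZ Y Y' YY) locr.
Qed.

Lemma conn_sum_r U X (I : Type) (r : seq I) (f : I -> M -> R) (Y : I -> M -> E)
    p : open U -> U p -> smooth_field_on A U X ->
  (forall i, smooth_fun_on A U (f i)) ->
    (forall i, smooth_field_on A U (Y i)) ->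
  D X (fun q => \sum_(i <- r) f i q *: Y i q) p =
  \sum_(i <- r) (dir_deriv A (f i) p (X p) *: Y i p + f i p *: D X (Y i) p).
Proof.
move=> oU Up sX sf sY; elim: r => [|i r IH].
  rewrite big_nil -[RHS](conn0r oU sX Up); congr (D _ _ _).
  by apply/funext => q; rewrite big_nil.
rewrite big_cons -IH -(conn_leibniz D oU)// -(conn_add D oU)//.
- by congr (D _ _ _); apply/funext => q; rewrite big_cons.
- exact: smooth_field_on_scale.
- by apply: smooth_field_on_sum => // j; exact: smooth_field_on_scale.
Qed.

Lemma conn_sum_l U Y (I : Type) (r : seq I) (f : I -> M -> R) (X : I -> M -> E)
    p : open U -> U p -> smooth_field_on A U Y ->
  (forall i, smooth_fun_on A U (f i)) ->
    (forall i, smooth_field_on A U (X i)) ->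
  D (fun q => \sum_(i <- r) f i q *: X i q) Y p =
  \sum_(i <- r) f i p *: D (X i) Y p.
Proof.
move=> oU Up sY sf sX; elim: r => [|i r IH].
  rewrite big_nil -[RHS](conn0l oU sY Up); congr (D _ _ _).
  by apply/funext => q; rewrite big_nil.
rewrite big_cons -IH -(conn_linear D oU)//.
- by congr (D _ _ _); apply/funext => q; rewrite big_cons.
- by apply: smooth_field_on_sum => // j; exact: smooth_field_on_scale.
Qed.

(* [conn_term D (p, Y) X] is the case of the preferred chart [c] at [p]. *)
Definition christoffel_form c p (X Y : E) : E :=
  \sum_i \sum_j (X 0 i * Y 0 j) *: christoffel D c p i j.

Lemma christoffel_form_linear_r c p (X : E) : linear (christoffel_form c p X).
Proof.
move=> a u v; rewrite /christoffel_form scaler_sumr -big_split;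
apply: eq_bigr => i _ /=.
rewrite scaler_sumr -big_split; apply: eq_bigr => j _ /=.
by rewrite !mxE scalerA -scalerDl mulrDr mulrCA.
Qed.

Lemma christoffel_form_linear_l c p (Y : E) : linear
  (christoffel_form c p ^~ Y).
Proof.
move=> a u v; rewrite /christoffel_form scaler_sumr -big_split;
apply: eq_bigr => i _ /=.
rewrite scaler_sumr -big_split; apply: eq_bigr => j _ /=.
by rewrite !mxE scalerA -scalerDl mulrDl mulrA.
Qed.

Lemma christoffel_formNl c p (X Y : E) : christoffel_form c p
  (- X) Y = - christoffel_form c p X Y.
Proof.
rewrite /christoffel_form -sumrN; apply: eq_bigr => i _; rewrite -sumrN.
by apply: eq_bigr => j _; rewrite mxE mulNr scaleNr.
Qed.

Lemma chart_field_sum c (F : E -> E) : chart_field c F =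
  fun q => \sum_(k < n) F (coord A c q) 0 k *: coord_field c k q.
Proof.
apply/funext => q; rewrite /chart_field [in LHS](row_sum_delta (F _)) tvec_sum.
by apply: eq_bigr => k _; rewrite tvecZ.
Qed.

Lemma coord_smooth_fun c U (F : E -> E) k : open U -> U `<=` dom A c ->
  smooth_on (chart_image c U) F -> smooth_fun_on A U (fun q =>
    F (coord A c q) 0 k).
Proof.
move=> oU Uc sF.
apply: (smooth_fun_on_coord (f := fun x => F x 0 k)) => //.
apply: (smooth_on_lin (l := row_coord k) (open_chart_image (c := c) oU) _ sF).
exact: row_coord_continuous.
Qed.

Lemma coord_field_smooth c U k : open U -> U `<=` dom A c ->
  smooth_field_on A U (coord_field c k).
Proof.
move=> oU Uc; apply: (smooth_chart_field (F := fun _ => delta_mx 0 k)) => //.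
exact: smooth_on_cst.
Qed.

(** The classical formula for a covariant derivative in coordinates. Both fields are expanded in the
    coordinate fields; [D] is linear over functions in the first, and the Leibniz rule on the second
    produces the differential of [F]. *)
Lemma conn_chart_field c U (F G : E -> E) p : open U -> U `<=` dom A c -> U p ->
  smooth_on (chart_image c U) F -> smooth_on (chart_image c U) G ->
  tcoord c p (D (chart_field c G) (chart_field c F) p) =
  'd F (coord A c p) (G (coord A c p)) +
  christoffel_form c p (G (coord A c p)) (F (coord A c p)).
Proof.
move=> oU Uc Up sF sG; have cp := Uc p Up.
have dF : differentiable F (coord A c p).
  by apply: smooth_on_differentiable sF _; exact: chart_image_coord.
have sCF k := coord_field_smooth k oU Uc.
rewrite (chart_field_sum c G) (conn_sum_l _ oU Up) => [|||//]; last first.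
- by move=> k; exact: coord_smooth_fun.
- exact: smooth_chart_field.
rewrite tcoord_sum.
have -> : 'd F (coord A c p) (G (coord A c p)) =
    \sum_i G (coord A c p) 0 i *: 'd F (coord A c p) (delta_mx 0 i).
  rewrite [in LHS](row_sum_delta (G _)) linear_sum.
  by apply: eq_bigr => i _; rewrite linearZ.
rewrite /christoffel_form -big_split; apply: eq_bigr => i _ /=.
rewrite tcoordZ (chart_field_sum c F) (conn_sum_r _ oU Up) => [||k|//];
last first.
- exact: coord_smooth_fun.
- exact: sCF.
rewrite tcoord_sum scaler_sumr.
rewrite [X in _ *: X + _](row_sum_delta ('d F _ _)) scaler_sumr -big_split /=.
apply: eq_bigr => j _; rewrite tcoordD !tcoordZ scalerDr !scalerA.
congr (_ + _); rewrite tvecK//; congr (_ * _ *: _).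
apply: (etrans (dir_deriv_coord (f := fun x => F x 0 j) _ cp _)).
  exact: (differentiable_comp dF (differentiable_coord _ _ _)).
by rewrite tvecK//; exact: diff_entry.
Qed.

(* Both sides are the components in [c'] of D_X Y, for the fields with constant
   components [X] and [Y] in [c]. *)
Lemma christoffel_transition c c' p (X Y : E) : dom A c p -> dom A c' p ->
  diff_transition c c' (coord A c p) (christoffel_form c p X Y) =
  'd (diff_transition c c' ^~ Y) (coord A c p) X +
  christoffel_form c' p (diff_transition c c' (coord A c p) X)
    (diff_transition c c' (coord A c p) Y).
Proof.
move=> cp cp'; pose U := dom A c `&` dom A c'.
have oU : open U by apply: openI; exact: open_dom.
have Up : U p by [].
have Uc : U `<=` dom A c by move=> q [].
have Uc' : U `<=` dom A c' by move=> q [].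
(* The components in [c'] of the field whose components in [c] are the constant [Z]. *)
pose F Z (x : E) : E := diff_transition c c' (transition c' c x) Z.
have sF Z : smooth_on (chart_image c' U) (F Z).
  apply: (smooth_on_comp (row_frame n) (open_chart_image (c := c') oU)
    (open_chart_image (c := c) (open_dom c')) _ _
      (diff_transition_smooth c c' Z)).
    by move=> _ [q [cq' [cq _]] <-]; rewrite transition_coord//;
    exact: chart_image_coord.
  by apply: smooth_on_sub (smooth_transition c' c); exact: chart_image_sub.
have FE Z q : U q -> chart_field c (cst Z) q = chart_field c' (F Z) q.
  by move=> [cq cq']; rewrite /chart_field /F transition_coord//
    tvec_diff_transition.
have FpE Z : F Z (coord A c' p) = diff_transition c c' (coord A c p) Z.
  by rewrite /F transition_coord.
have sC Z : smooth_field_on A U (chart_field c (cst Z)).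
  by apply: smooth_chart_field => //; exact: smooth_on_cst.
have E1 := conn_chart_field oU Uc Up (smooth_on_cst _ Y) (smooth_on_cst _ X).
have E2 := conn_chart_field oU Uc' Up (sF Y) (sF X).
rewrite !FpE in E2.
have E3 : D (chart_field c (cst X)) (chart_field c (cst Y)) p = D
  (chart_field c' (F X)) (chart_field c' (F Y)) p.
  by apply: (conn_eq oU Up _ _ (sC X) (sC Y)) => q; exact: FE.
(* Composed with [transition c c'], the map [F Y] becomes [diff_transition c c' ^~ Y] near the
   point, so the chain rule moves the derivative from [c'] back to [c]. *)
have E4 : 'd (F Y) (coord A c' p) (diff_transition c c' (coord A c p) X) =
    'd (diff_transition c c' ^~ Y) (coord A c p) X.
  have dFY : differentiable (F Y) (transition c c' (coord A c p)).
    rewrite transition_coord//; apply: smooth_on_differentiable (sF Y) _.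
    exact: chart_image_coord.
  have d1 := differentiable_transition cp cp'.
  rewrite -(transition_coord c' cp).
  apply: (etrans (esym (diff_compE X d1 dFY))).
  apply: near_eq_diffE.
    apply: (near_coord (open_dom c') cp cp') => q cq cq' /=.
    by rewrite /F (transition_coord c' cq) (transition_coord c cq').
  by apply: smooth_on_differentiable (diff_transition_smooth c c' Y) _;
  exact: chart_image_coord.
have E5 := diff_cstE Y (coord A c p) X.
rewrite -E4 -E2 -E3.
rewrite E5 add0r in E1; rewrite -E1 -(tcoord_tvec _ cp cp') tcoordK//.
Qed.

End Connections.

(** * Induced charts of the tangent bundle *)

Section TangentCharts.
Context {R : realType} {n : nat}.
Local Notation E := 'rV[R]_n.
Variable M : manifold R n.
Local Notation A := (mfd_atlas M).
Local Notation TA := (tangent_atlas M).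
Implicit Types (c : chart A) (p q : M) (z u v : E * E) (x y : E).

Let fE : frame E := row_frame n.

Definition tangent_transition c c' : E * E -> E * E :=
  coord TA c' \o param TA c.
Definition diff_tangent_transition c c' z u : E * E :=
  'd (tangent_transition c c') z u.

Lemma open_fst_chart_image c U : open U ->
  open [set z : E * E | chart_image c U z.1].
Proof. by move=> oU; apply: open_fst; exact: open_chart_image. Qed.

Lemma im_tangent c : im (A := TA) c = [set z | im c z.1].
Proof.
apply/seteqP; split=> [_ [[p v] cp <-]|[x y] [p cp /= px]]; first by exists p.
by exists (p, tvec c p y) => //=; rewrite tvecK// px.
Qed.

Lemma near_tangent c U p y (P : E * E -> Prop) : open U -> dom A c p -> U p ->
  (forall q y', dom A c q -> U q -> P (coord A c q, y')) ->
  \forall z \near (coord A c p, y), P z.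
Proof.
move=> oU cp Up UP.
apply: (@open_near _ _ [set z : E * E | chart_image c U z.1]).
- exact: open_fst_chart_image.
- exact: chart_image_coord.
- by move=> [x' y'] [q [cq Uq] /= <-]; exact: UP.
Qed.

Lemma param_tangent c p y : dom A c p ->
  param TA c (coord A c p, y) = (p, tvec c p y).
Proof. by move=> cp; rewrite /= param_coord. Qed.

Lemma coord_tangent c p y : dom A c p ->
  coord TA c (p, tvec c p y) = (coord A c p, y).
Proof. by move=> cp; rewrite /= tvecK. Qed.

Lemma tangent_transitionE c c' p y : dom A c p -> dom A c' p ->
  tangent_transition c c' (coord A c p, y) =
    (coord A c' p, diff_transition c c' (coord A c p) y).
Proof. by move=> cp cp'; rewrite /tangent_transition /comp param_tangent//=
  tcoord_tvec. Qed.

(** [tangent_transition] passes through the preferred chart of the moving point and cannot be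
    differentiated directly. This map agrees with it over the overlap and makes no such detour. *)
Let bundle_map c c' z : E * E :=
  (transition c c' z.1, diff_transition c c' z.1 z.2).

Let transition_fst_diff c c' p y : dom A c p -> dom A c' p ->
  differentiable (transition c c' \o fst) (coord A c p, y).
Proof.
move=> cp cp'; apply: differentiable_comp;
last exact: differentiable_transition.
by apply: linear_differentiable; exact: fst_continuous.
Qed.

Lemma diff_transition_param_smooth c c' :
  smooth_on [set z : E * E | chart_image c (dom A c') z.1] (fun z =>
    diff_transition c c' z.1 z.2).
Proof.
exact: (smooth_on_linear_param fE fE (open_chart_image (c := c) (open_dom c'))
  (diff_transition_linear c c') (diff_transition_smooth c c')).
Qed.

Let diff_transition_param_diff c c' p y : dom A c p -> dom A c' p ->
  differentiable (fun z => diff_transition c c' z.1 z.2) (coord A c p, y).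
Proof.
move=> cp cp'; apply: smooth_on_differentiable
  (diff_transition_param_smooth c c') _.
exact: chart_image_coord.
Qed.

Let tangent_transition_near c c' p y : dom A c p -> dom A c' p ->
  {near (coord A c p, y), bundle_map c c' =1 tangent_transition c c'}.
Proof.
move=> cp cp'; apply: (near_tangent y (open_dom c') cp cp') => q y' cq cq'.
by rewrite tangent_transitionE// /bundle_map /= transition_coord.
Qed.

Lemma differentiable_tangent_transition c c' p y : dom A c p -> dom A c' p ->
  differentiable (tangent_transition c c') (coord A c p, y).
Proof.
move=> cp cp'; apply: near_eq_differentiable
  (tangent_transition_near y cp cp') _.
by apply: differentiable_pair;
[exact: transition_fst_diff|exact: diff_transition_param_diff].
Qed.

(** The base part of [u] enters the fibre component through the second derivative of the transition
    map: this term is what must cancel later in every invariance proof. *)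
Lemma diff_tangent_transitionE c c' p y u : dom A c p -> dom A c' p ->
  diff_tangent_transition c c' (coord A c p, y) u =
  (diff_transition c c' (coord A c p) u.1,
   'd (diff_transition c c' ^~ y) (coord A c p) u.1 + diff_transition c c'
     (coord A c p) u.2).
Proof.
move=> cp cp'; have d1 := transition_fst_diff y cp cp'.
have d2 := diff_transition_param_diff y cp cp'.
have d12 : differentiable (bundle_map c c') (coord A c p, y).
  exact: differentiable_pair.
apply: (etrans (near_eq_diffE u (tangent_transition_near y cp cp') d12)).
apply: (etrans (congr1 (fun h : E * E -> E * E => h u) (diff_pair d1 d2))).
congr pair.
  have dfst : differentiable (fst : E * E -> E) (coord A c p, y).
    by apply: linear_differentiable; exact: fst_continuous.
  apply: (etrans (diff_compE u dfst (differentiable_transition cp cp'))).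
  congr ('d _ _ _); apply: diff_linE; exact: fst_continuous.
apply: (diff_linear_param fE fE (open_chart_image (c := c) (open_dom c'))
  (diff_transition_linear c c') (diff_transition_smooth c c')).
exact: chart_image_coord.
Qed.

Local Opaque diff_transition.

Lemma diff_tangent_transitionK c c' p y u : dom A c p -> dom A c' p ->
  diff_tangent_transition c' c (tangent_transition c c' (coord A c p, y))
    (diff_tangent_transition c c' (coord A c p, y) u) = u.
Proof.
move=> cp cp'; have d1 := differentiable_tangent_transition y cp cp'.
have d2 : differentiable (tangent_transition c' c) (tangent_transition c c'
  (coord A c p, y)).
  by rewrite tangent_transitionE//; exact: differentiable_tangent_transition.
apply: (etrans (esym (diff_compE u d1 d2))).
have cid : continuous (idfun : E * E -> E * E) by move=> ?.
apply: etrans (diff_linE (coord A c p, y) u cid).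
apply: near_eq_diffE; last exact: linear_differentiable.
apply: (near_tangent y (open_dom c') cp cp') => q y' cq cq'.
by rewrite /comp (tangent_transitionE _ cq cq') (tangent_transitionE _ cq' cq)
  (diff_transition_comp _ cq cq' cq) diff_transition_id.
Qed.

Lemma tvec_tangent c p y u : dom A c p ->
  tvec (A := TA) c (p, tvec c p y) u = diff_tangent_transition c
    (chart_at A p) (coord A c p, y) u.
Proof. by move=> cp; rewrite -[in RHS]coord_tangent. Qed.

Lemma tcoord_tangent c p y u : dom A c p ->
  tcoord (A := TA) c (p, tvec c p y) u =
  diff_tangent_transition (chart_at A p) c (tangent_transition c
    (chart_at A p) (coord A c p, y)) u.
Proof. by move=> cp; rewrite /tangent_transition /comp param_tangent. Qed.

Local Opaque diff_tangent_transition.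

Lemma tvecK_tangent c p y u : dom A c p ->
  tcoord (A := TA) c (p, tvec c p y) (tvec (A := TA) c (p, tvec c p y) u) = u.
Proof.
move=> cp; rewrite tvec_tangent// tcoord_tangent//.
by rewrite diff_tangent_transitionK//; exact: dom_chart_at.
Qed.

(** The transition from [c] to itself is the identity near the point, so its differential inverts
    itself and supplies the components. Forms can thus be compared through their coefficients in a
    chart. *)
Lemma tvec_tangent_surj p y u :
  exists u', u = tvec (A := TA) (chart_at A p) (p, y) u'.
Proof.
have cp := dom_chart_at p; set c := chart_at A p in cp *.
have [y' ->] : exists y', y = tvec c p y'.
  by exists (tcoord c p y); rewrite tcoordK.
exists (diff_tangent_transition c c (coord A c p, y') u).
rewrite tvec_tangent//; have := diff_tangent_transitionK y' u cp cp.
by rewrite (tangent_transitionE y' cp cp) (diff_transition_id y' cp) => ->.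
Qed.

Section Connection.
Variable D : affine_connection M.

Definition christoffel_in_chart c x (X Y : E) : E :=
  christoffel_form D c (param A c x) X Y.

Lemma christoffel_in_chart_smooth c X Y : smooth_on (im c) (fun x =>
  christoffel_in_chart c x X Y).
Proof.
have oI := open_im c.
apply: smooth_on_sum => // i; apply: smooth_on_sum => // j.
apply: smooth_on_scale => //; first exact: smooth_on_cst.
have sC k := coord_field_smooth (c := c) k (open_dom c) (@subset_refl _ _).
have := conn_smooth D (open_dom c) (sC i) (sC j) c.
by rewrite /im setIid.
Qed.

Definition ver_in_chart c z u : E := u.2 + christoffel_in_chart c z.1 u.1 z.2.

Lemma hor_tvec c p y u : dom A c p ->
  hor (tvec (A := TA) c (p, tvec c p y) u) = tvec c p u.1.
Proof.
by move=> cp; rewrite tvec_tangent// diff_tangent_transitionE//;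
exact: dom_chart_at.
Qed.

Lemma ver_tvec c p y u : dom A c p ->
  ver D (p, tvec c p y) (tvec (A := TA) c (p, tvec c p y) u) =
  tvec c p (ver_in_chart c (coord A c p, y) u).
Proof.
move=> cp; have cp0 := dom_chart_at p.
rewrite tvec_tangent// diff_tangent_transitionE// /ver -[conn_term _ _
  _]/(christoffel_form D (chart_at A p) p _ _) /=.
rewrite /ver_in_chart /christoffel_in_chart /= param_coord// tvecD addrAC
  [RHS]addrC; congr (_ + _).
by rewrite !tvecE (christoffel_transition D u.1 y cp cp0).
Qed.

End Connection.
End TangentCharts.

(** * The natural almost Hermitian structure *)

Section NaturalHermitian.
Context {R : realType} {n : nat}.
Local Notation E := 'rV[R]_n.
Variables (M : manifold R n) (g : riemannian_metric M)
  (D : affine_connection M).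
Local Notation A := (mfd_atlas M).
Local Notation TA := (tangent_atlas M).
Implicit Types (c : chart A) (p q : M) (z u v : E * E) (x y : E).

Let fE : frame E := row_frame n.

Local Opaque tvec tcoord.

Definition metric_in_chart c x (X Y : E) : R := bilin_in_chart g c X Y x.

Lemma metric_linear_l p (Y : E) : linear (g p ^~ Y : E -> R).
Proof. by move=> a u v; have [glin _ _ _] := metricP g; exact: glin. Qed.

Lemma metric_linear_r p (X : E) : linear (g p X : E -> R).
Proof. exact: metric_linear. Qed.

Lemma metric_sym p (X Y : E) : g p X Y = g p Y X.
Proof. by have [_ gsym _ _] := metricP g. Qed.

Lemma metricNl p (X Y : E) : g p (- X) Y = - g p X Y.
Proof.
have := metric_linear_l p Y (-1) X 0.
by rewrite addr0 scaleN1r /= metric0l addr0 scaleN1r.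
Qed.

Lemma metricNr p (X Y : E) : g p X (- Y) = - g p X Y.
Proof. by rewrite metric_sym metricNl metric_sym. Qed.

Lemma metric_in_chart_linear_l c x y : linear (metric_in_chart c x ^~ y : E ->
  R).
Proof.
move=> a u v; rewrite /metric_in_chart /bilin_in_chart tvecD tvecZ.
exact: metric_linear_l.
Qed.

Lemma metric_in_chart_linear_r c x y : linear (metric_in_chart c x y : E -> R).
Proof.
move=> a u v; rewrite /metric_in_chart /bilin_in_chart tvecD tvecZ.
exact: metric_linear_r.
Qed.

Lemma metric_in_chart_smooth c X Y : smooth_on (im c) (fun x =>
  metric_in_chart c x X Y).
Proof. by have [_ _ _] := metricP g; exact. Qed.

Lemma metric_in_chart_coord c p X Y : dom A c p ->
  metric_in_chart c (coord A c p) X Y = g p (tvec c p X) (tvec c p Y).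
Proof. by move=> cp; rewrite /metric_in_chart /bilin_in_chart param_coord. Qed.

Let TU c : set (E * E) := [set z | im c z.1].

Let openTU c : open (TU c).
Proof. by apply: open_fst; exact: open_im. Qed.

Let fst_smooth c : smooth_on (TU c) (fst : E * E -> E).
Proof. by apply: smooth_on_linear; exact: fst_continuous. Qed.

Let snd_smooth c : smooth_on (TU c) (snd : E * E -> E).
Proof. by apply: smooth_on_linear; exact: snd_continuous. Qed.

Lemma metric_in_chart_smooth_comp c (X Y : E * E -> E) :
  smooth_on (TU c) X -> smooth_on (TU c) Y ->
  smooth_on (TU c) (fun z => metric_in_chart c z.1 (X z) (Y z)).
Proof.
exact: (smooth_on_bilinear_param fE fE fE (@openTU c) (open_im c) _
  (metric_in_chart_linear_l c) (metric_in_chart_linear_r c)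
    (metric_in_chart_smooth c) (@fst_smooth c)).
Qed.

Lemma christoffel_in_chart_smooth_comp c (X Y : E * E -> E) :
  smooth_on (TU c) X -> smooth_on (TU c) Y ->
  smooth_on (TU c) (fun z => christoffel_in_chart D c z.1 (X z) (Y z)).
Proof.
exact: (smooth_on_bilinear_param fE fE fE (@openTU c) (open_im c) _
  (fun x => christoffel_form_linear_l D c (param A c x))
  (fun x => christoffel_form_linear_r D c (param A c x))
    (christoffel_in_chart_smooth D c)
  (@fst_smooth c)).
Qed.

Lemma ver_in_chart_smooth c u : smooth_on (TU c) (fun z =>
  ver_in_chart D c z u).
Proof.
apply: smooth_on_add => //; first exact: smooth_on_cst.
by apply: christoffel_in_chart_smooth_comp => //; exact: smooth_on_cst.
Qed.

Lemma nat_metric_chart c p y u v : dom A c p ->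
  bilin_in_chart (A := TA) (nat_metric g D) c u v (coord A c p, y) =
  metric_in_chart c (coord A c p) u.1 v.1 +
  metric_in_chart c (coord A c p) (ver_in_chart D c (coord A c p, y) u)
    (ver_in_chart D c (coord A c p, y) v).
Proof.
move=> cp; rewrite /bilin_in_chart param_tangent// /nat_metric.
rewrite (hor_tvec y u cp) (hor_tvec y v cp).
by rewrite (ver_tvec D y u cp) (ver_tvec D y v cp) !metric_in_chart_coord.
Qed.

Lemma conn_termN xi X : conn_term D xi (- X) = - conn_term D xi X.
Proof. exact: christoffel_formNl. Qed.

(** On horizontal and vertical parts [nat_J] is the rotation [(h, v) |-> (- v, h)]. Since a vector
    is determined by its two parts, identities for [nat_J] are checked on them. *)
Lemma hor_nat_J xi B : hor (nat_J D xi B) = - ver D xi B.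
Proof. by rewrite /nat_J /hor /= sub0r. Qed.

Lemma ver_nat_J xi B : ver D xi (nat_J D xi B) = hor B.
Proof.
by rewrite {1}/ver -/(hor _) hor_nat_J conn_termN /nat_J /= opprK addrK.
Qed.

Lemma hor_ver_inj xi B C : hor B = hor C -> ver D xi B = ver D xi C -> B = C.
Proof. by move=> hBC vBC; rewrite (lift_decomp D xi B) hBC vBC -lift_decomp.
  Qed.

Lemma kahler_form_chart c p y u v : dom A c p ->
  bilin_in_chart (A := TA) (kahler_form (nat_J D) (nat_metric g D)) c u v
    (coord A c p, y) =
  metric_in_chart c (coord A c p) u.1 (ver_in_chart D c (coord A c p, y) v) -
  metric_in_chart c (coord A c p) (ver_in_chart D c (coord A c p, y) u) v.1.
Proof.
move=> cp; rewrite /bilin_in_chart param_tangent// /kahler_form /nat_metric.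
rewrite hor_nat_J ver_nat_J (hor_tvec y u cp) (hor_tvec y v cp).
rewrite (ver_tvec D y u cp) (ver_tvec D y v cp) !metric_in_chart_coord//.
by rewrite metricNl addrC.
Qed.

(** With [V] the vertical part of [u], the base component must be [- V]; the fibre component is the
    solution [b] of [b + Gamma(- V, y) = u.1], as the vertical part of the image is [u.1]. *)
Definition nat_J_in_chart c z u : E * E :=
  (- ver_in_chart D c z u, u.1 + christoffel_in_chart D c z.1
    (ver_in_chart D c z u) z.2).

Lemma nat_J_chart c p y u : dom A c p ->
  tcoord (A := TA) c (p, tvec c p y)
    (nat_J D (p, tvec c p y) (tvec (A := TA) c (p, tvec c p y) u)) =
  nat_J_in_chart c (coord A c p, y) u.
Proof.
move=> cp; rewrite -[RHS](tvecK_tangent y _ cp); congr tcoord.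
apply: (@hor_ver_inj (p, tvec c p y)).
  rewrite hor_nat_J (ver_tvec D y u cp) (hor_tvec y _ cp) -scaleN1r -tvecZ.
  by rewrite scaleN1r.
rewrite ver_nat_J (hor_tvec y u cp) (ver_tvec D y _ cp); congr tvec.
rewrite {1}/ver_in_chart /=; set V := ver_in_chart _ _ _ _.
by rewrite /christoffel_in_chart christoffel_formNl addrK.
Qed.

Lemma nat_J_in_chart_smooth c u : smooth_on (TU c) (fun z =>
  nat_J_in_chart c z u).
Proof.
have oT := @openTU c; have sV := ver_in_chart_smooth c u.
apply: smooth_on_pair => //; first exact: smooth_on_opp.
apply: smooth_on_add => //; first exact: smooth_on_cst.
exact: christoffel_in_chart_smooth_comp.
Qed.

Lemma ver_linear xi : linear (ver D xi).
Proof.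
move=> a B C; rewrite /ver.
have -> : conn_term D xi (a *: B + C).1 =
    a *: conn_term D xi B.1 + conn_term D xi C.1.
  exact: (christoffel_form_linear_l D (chart_at A xi.1) xi.1 xi.2).
by rewrite scalerDr addrACA.
Qed.

Lemma nat_J_linear xi : linear (nat_J D xi).
Proof.
move=> a B C; apply: (@hor_ver_inj xi).
  rewrite -[RHS]/(a *: hor (nat_J D xi B) + hor (nat_J D xi C)) !hor_nat_J.
  rewrite ver_linear.
  by rewrite opprD scalerN.
by rewrite ver_nat_J ver_linear !ver_nat_J.
Qed.

Lemma nat_JK xi B : nat_J D xi (nat_J D xi B) = - B.
Proof.
have verN : ver D xi (- B) = - ver D xi B.
  have := ver_linear xi (-1) B 0; rewrite addr0 !scaleN1r => ->.
  by rewrite /ver conn_term0 !addr0.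
apply: (@hor_ver_inj xi); first by rewrite hor_nat_J ver_nat_J.
by rewrite ver_nat_J hor_nat_J verN.
Qed.

Lemma nat_metric_riemannian : is_riemannian TA (nat_metric g D).
Proof.
split.
- move=> xi a B C B'; rewrite /nat_metric ver_linear.
  have gl p := metric_linear_l p.
  rewrite (gl xi.1 (ver D xi B') a) /hor /= (gl xi.1 B'.1 a) /=.
  by rewrite mulrDr addrACA.
- by move=> xi B C; rewrite /nat_metric metric_sym (metric_sym _ (ver D xi B)).
- move=> xi B B0; have [_ _ gpos _] := metricP g.
  have g0 p X : 0 <= g p X X.
    have [->|/gpos/ltW//] := eqVneq X 0; by rewrite metric0l.
  (* Both summands of the metric are nonnegative, and one is positive, because a vector whose two
     parts vanish is zero. *)
  have [hB|hB] := eqVneq (hor B) 0; last first.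
    by rewrite /nat_metric ltr_wpDr ?g0// gpos.
  rewrite /nat_metric ltr_wpDl ?g0// gpos//; apply: contra_neq B0 => vB.
  apply: (@hor_ver_inj xi); first by rewrite hB.
  by rewrite vB /ver conn_term0 addr0.
- move=> c u v; rewrite im_tangent.
  apply: (@smooth_on_eq _ _ _ _ (fun z => metric_in_chart c z.1 u.1 v.1 +
    metric_in_chart c z.1 (ver_in_chart D c z u) (ver_in_chart D c z v)));
    first exact: openTU.
    by move=> [x y] [p cp /= <-]; rewrite nat_metric_chart.
  apply: smooth_on_add; first exact: openTU.
    by apply: metric_in_chart_smooth_comp; exact: smooth_on_cst.
  by apply: metric_in_chart_smooth_comp; exact: ver_in_chart_smooth.
Qed.

Lemma nat_J_almost_complex : is_almost_complex TA (nat_J D).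
Proof.
split; [exact: nat_J_linear|exact: nat_JK|move=> c u; rewrite im_tangent].
apply: (smooth_on_eq (@openTU c) _ (nat_J_in_chart_smooth c u)).
move=> [x y] [p cp px]; have -> : x = coord A c p by rewrite px.
by rewrite (param_tangent y cp); exact: esym (nat_J_chart y u cp).
Qed.

(** True for every [g] and [D], so that in the theorem only closedness is at stake. *)
Lemma nat_almost_hermitian :
  is_almost_hermitian TA (nat_J D) (nat_metric g D).
Proof.
split; [exact: nat_J_almost_complex|exact: nat_metric_riemannian|].
move=> xi B C; rewrite /nat_metric !hor_nat_J !ver_nat_J.
by rewrite metricNl metricNr opprK addrC.
Qed.

End NaturalHermitian.

(** * The pull-back of the canonical form *)

Section CanonicalForm.
Context {R : realType} {n : nat}.
Local Notation E := 'rV[R]_n.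
Variables (M : manifold R n) (g : riemannian_metric M).
Local Notation A := (mfd_atlas M).
Local Notation TA := (tangent_atlas M).
Local Notation CA := (cotangent_atlas M).
Implicit Types (c : chart A) (p q : M) (z u v w : E * E) (x y b : E).

Let fE : frame E := row_frame n.

(** Both sides are second derivatives of the transition map; symmetry is proved for real functions,
    hence applied to each component [f]. *)
Lemma diff_transition_sym c c' p a b : dom A c p -> dom A c' p ->
  'd (diff_transition c c' ^~ a) (coord A c p) b = 'd
    (diff_transition c c' ^~ b) (coord A c p) a.
Proof.
move=> cp cp'; have oI := open_chart_image (c := c) (open_dom c').
have Ip : chart_image c (dom A c') (coord A c p) by exact: chart_image_coord.
have s1 := smooth_transition c c'; have sd := diff_transition_smooth c c'.
apply/rowP => i; pose f x : R := transition c c' x 0 i.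

have sf : smooth_on (chart_image c (dom A c')) f.
  exact: (smooth_on_lin (l := row_coord i) oI (@row_coord_continuous _ _ i) s1).
have fE1 (v : E) : {near coord A c p, (fun x =>
  diff_transition c c' x v 0 i : R) =1
    (fun x => 'd f x v)}.
  apply: (open_near oI Ip) => x Ix; apply/esym/diff_entry.
  exact: smooth_on_differentiable s1 Ix.
have key (v w : E) : ('d (diff_transition c c' ^~ v) (coord A c p) w) 0 i =
    'd (fun x => 'd f x v) (coord A c p) w.
  have dv := smooth_on_differentiable (sd v) Ip.
  apply: (etrans (esym (diff_entry i w dv))); apply/esym.
  apply: near_eq_diffE (fE1 v) _.
  exact: (differentiable_comp dv (differentiable_coord _ _ _)).
by rewrite !key; exact: (second_diff_sym a b oI (sf 2%N) Ip).
Qed.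

Local Opaque tvec tcoord diff_transition diff_tangent_transition
  metric_in_chart.

Let TU c : set (E * E) := [set z | im c z.1].

Let openTU c : open (TU c).
Proof. by apply: open_fst; exact: open_im. Qed.

(* The value of the Liouville form [sum_i z_i dx^i], pulled back by [flat g] to
   the chart [c], on the vectors at [z] with base component [b]. *)
Definition liouville c z b : R := metric_in_chart g c z.1 z.2 b.

Lemma liouville_linear c z : linear (liouville c z : E -> R).
Proof. exact: metric_in_chart_linear_r. Qed.

Lemma liouville_smooth c b : smooth_on (TU c) (liouville c ^~ b).
Proof.
apply: metric_in_chart_smooth_comp; last exact: smooth_on_cst.
by apply: smooth_on_linear; exact: snd_continuous.
Qed.

Lemma diff_liouville_linear c z u : TU c z ->
  linear (fun b => 'd (liouville c ^~ b) z u : R).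
Proof.
exact: (diff_param_linear (@liouville_linear c) (liouville_smooth c)).
Qed.

(** Minus the exterior derivative of the Liouville form on the constant fields [u] and [v]; the sign
    comes from [sum_i dx^i /\ dz_i = - d (sum_i z_i dx^i)]. *)
Definition canonical_in_chart c z u v : R :=
  'd (liouville c ^~ u.1) z v - 'd (liouville c ^~ v.1) z u.

Lemma liouville_transition c c' p y b : dom A c p -> dom A c' p ->
  liouville c (coord A c p, y) b =
  liouville c' (tangent_transition c c' (coord A c p, y))
    (diff_transition c c' (coord A c p) b).
Proof.
move=> cp cp'; rewrite tangent_transitionE// /liouville /=
  !metric_in_chart_coord//.
by rewrite !(tvec_diff_transition _ cp cp').
Qed.

(** The derivative of [liouville_transition] along [v]. The components in [c'] of the constant
    vector [b] vary with the point, whence the extra term, symmetric in [b] and [v.1]. *)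
Lemma diff_liouville_transition c c' p y b v : dom A c p -> dom A c' p ->
  'd (liouville c ^~ b) (coord A c p, y) v =
  'd (liouville c' ^~ (diff_transition c c' (coord A c p) b))
    (tangent_transition c c' (coord A c p, y))
    (diff_tangent_transition c c' (coord A c p, y) v) +
  liouville c' (tangent_transition c c' (coord A c p, y)) ('d
    (diff_transition c c' ^~ b) (coord A c p) v.1).
Proof.
move=> cp cp'; set z := (_, y);
have d1 := differentiable_tangent_transition y cp cp'.
have dfst : differentiable (fst : E * E -> E) z.
  by apply: linear_differentiable; exact: fst_continuous.
have db : differentiable (diff_transition c c' ^~ b) z.1.
  apply: smooth_on_differentiable (diff_transition_smooth c c' b) _;
  exact: chart_image_coord.
have d2 := differentiable_comp dfst db.
have d12 := differentiable_pair d1 d2.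
have oT' := @openTU c'.
have zT' : TU c' (tangent_transition c c' z).
  by rewrite /z tangent_transitionE//; exists p.
have sK := smooth_on_linear_param (pair_frame fE fE) fE oT'
  (@liouville_linear c')
  (liouville_smooth c').
have dK : differentiable (fun t : (E * E) * E => liouville c' t.1 t.2)
    (tangent_transition c c' z, (diff_transition c c' ^~ b \o fst) z).
  exact: smooth_on_differentiable sK _.
pose G (t : E * E) := liouville c' (tangent_transition c c' t)
  (diff_transition c c' t.1 b).
have GE : {near z, G =1 liouville c ^~ b}.
  apply: (near_tangent y (open_dom c') cp cp') => q y' cq cq'.
  by rewrite (liouville_transition y' b cq cq').
have dG : differentiable G z by exact: (differentiable_comp d12 dK).
apply: (etrans (near_eq_diffE v GE dG)).
apply: (etrans (diff_compE v d12 dK)).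
have E12 : 'd (fun t => (tangent_transition c c' t,
  (diff_transition c c' ^~ b \o fst) t)) z v =
    (diff_tangent_transition c c' z v, 'd (diff_transition c c' ^~ b)
      (coord A c p) v.1).
  apply: (etrans (congr1 (fun h : E * E -> (E * E) * E =>
    h v) (diff_pair d1 d2))).
  congr pair; apply: (etrans (diff_compE v dfst db)).
  by congr ('d _ _ _); apply: diff_linE; exact: fst_continuous.
rewrite E12.
exact: (diff_linear_param (pair_frame fE fE) fE oT' (@liouville_linear c')
  (liouville_smooth c') (z := (tangent_transition c c' z, diff_transition c c'
    (coord A c p) b))
  (diff_tangent_transition c c' z v, 'd (diff_transition c c' ^~ b)
    (coord A c p) v.1) zT').
Qed.

(* The second derivatives of the transition map cancel by symmetry. *)
Lemma canonical_in_chart_transition c c' p y u v : dom A c p -> dom A c' p ->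
  canonical_in_chart c (coord A c p, y) u v = canonical_in_chart c'
    (tangent_transition c c' (coord A c p, y))
    (diff_tangent_transition c c' (coord A c p, y) u)
      (diff_tangent_transition c c' (coord A c p, y) v).
Proof.
move=> cp cp'; have E1 := diff_liouville_transition y u.1 v cp cp'.
have E2 := diff_liouville_transition y v.1 u cp cp'.
apply: (etrans (congr2 (fun r s : R => r - s) E1 E2)).
have E3 := congr1 (liouville c' (tangent_transition c c' (coord A c p, y)))
  (diff_transition_sym u.1 v.1 cp cp').
rewrite E3 opprD addrACA subrr addr0 /canonical_in_chart.
by rewrite (diff_tangent_transitionE y u cp cp')
  (diff_tangent_transitionE y v cp cp').
Qed.

Lemma flat_chart c p y : dom A c p ->
  (coord CA c \o flat g \o param TA c) (coord A c p, y) =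
  (coord A c p, \row_i liouville c (coord A c p, y) (delta_mx 0 i)).
Proof.
move=> cp; rewrite /comp (param_tangent y cp).
transitivity (coord A c p,
  \row_i g p (tvec c p y) (tvec c p (delta_mx 0 i))); first by [].
have NE (i : 'I_n) : g p (tvec c p y) (tvec c p (delta_mx 0 i)) =
    liouville c (coord A c p, y) (delta_mx 0 i) by rewrite
      -metric_in_chart_coord.
apply: (congr1 (pair (coord A c p))); apply/rowP => i.
by rewrite [LHS]mxE [RHS]mxE.
Qed.

(** [tangent_map] uses preferred charts at both ends; they come from the same chart [c], as [flat g]
    keeps the base point. There the coordinate [z_i] of [flat g] is the Liouville form on the i-th
    basis vector. *)
Lemma tangent_map_flat p y (B : E * E) : let c := chart_at A p in
  tangent_map TA CA (flat g) (p, y) B =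
  (B.1, \row_i 'd (liouville c ^~ (delta_mx 0 i)) (coord TA c (p, y)) B).
Proof.
move=> c; have cp : dom A c p := dom_chart_at p.
rewrite /tangent_map -/c; set z := coord TA c (p, y).
have zE : z = (coord A c p, tcoord c p y) by [].
have zT : TU c z by exists p.
pose G (t : E * E) : E * E := (t.1, \row_i liouville c t (delta_mx 0 i)).
have GE : {near z, G =1 coord CA c \o flat g \o param TA c}.
  rewrite zE; apply: (near_tangent _ (open_dom c) cp cp) => q y' cq _.
  by rewrite flat_chart.
have dfst : differentiable (fst : E * E -> E) z.
  by apply: linear_differentiable; exact: fst_continuous.
have sN : smooth_on (TU c) (fun t => \row_i liouville c t (delta_mx 0 i)).
  by apply: smooth_on_row => // i; exact: liouville_smooth.
have dN := smooth_on_differentiable sN zT.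
have dG : differentiable G z by exact: differentiable_pair.
apply: (etrans (near_eq_diffE B GE dG)).
apply: (etrans (congr1 (fun h : E * E -> E * E => h B) (diff_pair dfst dN))).
congr pair; first by apply: diff_linE; exact: fst_continuous.
apply/rowP => i; rewrite [RHS]mxE; apply: (etrans (esym (diff_entry i B dN))).
by congr ('d _ _ _); apply/funext => t; rewrite mxE.
Qed.

Lemma diff_liouville_sum c z b u : TU c z ->
  'd (liouville c ^~ b) z u = \sum_i b 0 i * 'd (liouville c ^~
    (delta_mx 0 i)) z u.
Proof.
move=> zT; pose l : {linear E -> R} := HB.pack (fun b =>
  'd (liouville c ^~ b) z u : R)
  (GRing.isLinear.Build _ _ _ _ _ (diff_liouville_linear u zT)).
rewrite -[LHS]/(l b) [in LHS](row_sum_delta b) linear_sum.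
by apply: eq_bigr => i _; exact: linearZ.
Qed.

(** The sums over [i] in the canonical form recombine, since the differential of the Liouville form
    is linear in its base argument ([diff_liouville_sum]). *)
Lemma pullback_chart_at p y B C : let c := chart_at A p in
  pullback TA CA (flat g) (@canonical_symplectic R n M) (p, y) B C =
  canonical_in_chart c (coord TA c (p, y)) B C.
Proof.
move=> c; have zT : TU c (coord TA c (p, y)).
  by exists p => //; exact: dom_chart_at.
rewrite /pullback !tangent_map_flat /canonical_symplectic -/c.
apply: etrans (congr2 (fun r s : R =>
  r - s) (esym (diff_liouville_sum B.1 C zT))
  (esym (diff_liouville_sum C.1 B zT))).
rewrite -sumrB; apply: eq_bigr => i _.
congr (_ * _ - _ * _); exact: mxE.
Qed.

(** Passes from the preferred chart, which changes with the point, to a fixed chart [c], in which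
    the pull-back can be differentiated. *)
Lemma pullback_chart c p y u v : dom A c p ->
  bilin_in_chart (A := TA)
    (pullback TA CA (flat g) (@canonical_symplectic R n M)) c u v
    (coord A c p, y) = canonical_in_chart c (coord A c p, y) u v.
Proof.
move=> cp; rewrite (canonical_in_chart_transition y u v cp (dom_chart_at p)).
rewrite /bilin_in_chart (param_tangent y cp) pullback_chart_at.
by rewrite (tvec_tangent y u cp) (tvec_tangent y v cp) -(param_tangent y cp).
Qed.

Lemma diff_liouville_smooth c b u : smooth_on (TU c) (fun z =>
  'd (liouville c ^~ b) z u).
Proof. exact: smooth_on_diff (liouville_smooth c b). Qed.

Lemma canonical_in_chart_smooth c u v : smooth_on (TU c) (fun z =>
  canonical_in_chart c z u v).
Proof.
have oT := @openTU c; apply: smooth_on_add => //;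
first exact: diff_liouville_smooth.
by apply: smooth_on_opp => //; exact: diff_liouville_smooth.
Qed.

Lemma diff_canonical_in_chart c z u v w : TU c z ->
  'd (fun t => canonical_in_chart c t u v) z w =
  'd (fun t => 'd (liouville c ^~ u.1) t v) z w - 'd (fun t =>
    'd (liouville c ^~ v.1) t u) z w.
Proof.
move=> zT.
have d1 := smooth_on_differentiable (diff_liouville_smooth c u.1 v) zT.
have d2 := smooth_on_differentiable (diff_liouville_smooth c v.1 u) zT.
exact: (congr1 (fun h : E * E -> R => h w) (diffB d1 d2)).
Qed.

(** Six second derivatives cancel in pairs: one pair for each of the Liouville functions of [u.1],
    [v.1] and [w.1], by symmetry of second derivatives. *)
Lemma canonical_in_chart_closed c z u v w : TU c z ->
  'd (fun t => canonical_in_chart c t v w) z u - 'd (fun t =>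
    canonical_in_chart c t u w) z v +
  'd (fun t => canonical_in_chart c t u v) z w = 0.
Proof.
move=> zT.
have alg (a a' b b' d d' : R) : a = a' -> b = b' -> d = d' ->
    (b' - a') - (d' - a) + (d - b) = 0.
  by move=> -> -> ->; rewrite opprB !subrKA subrr.
apply: (etrans (congr2 +%R (congr2 (fun r s : R => r - s)
  (diff_canonical_in_chart v w u zT) (diff_canonical_in_chart u w v zT))
    (diff_canonical_in_chart u v w zT))).
have sym b a a' := second_diff_sym a a' (@openTU c)
  (liouville_smooth c b 2%N) zT.
exact: (alg _ _ _ _ _ _ (sym w.1 u v) (sym v.1 u w) (sym u.1 v w)).
Qed.

Lemma pullback_closed :
  closed_form TA (pullback TA CA (flat g) (@canonical_symplectic R n M)).
Proof.
move=> c z; rewrite im_tangent => -[p cp pz] u v w.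
have {pz}-> : z = (coord A c p, z.2) by case: z pz => x y /= ->.
set z' := (_, _); have zT : TU c z' by exists p.
have near_canonical (a b : E * E) : {near z', (fun t =>
  canonical_in_chart c t a b) =1 bilin_in_chart (A := TA)
    (pullback TA CA (flat g) (@canonical_symplectic R n M)) c a b}.
  apply: (near_tangent _ (open_dom c) cp cp) => q y' cq _.
  exact: esym (pullback_chart y' a b cq).
have dPC (a b : E * E) := smooth_on_differentiable
  (canonical_in_chart_smooth c a b) zT.
apply: etrans (canonical_in_chart_closed u v w zT).
have E1 := near_eq_diffE u (near_canonical v w) (dPC v w).
have E2 := near_eq_diffE v (near_canonical u w) (dPC u w).
have E3 := near_eq_diffE w (near_canonical u v) (dPC u v).
exact: (congr2 +%R (congr2 (fun r s : R => r - s) E1 E2) E3).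
Qed.

End CanonicalForm.

(** * Comparison of the two forms *)

Section Main.
Context {R : realType} {n : nat}.
Local Notation E := 'rV[R]_n.
Variables (M : manifold R n) (g : riemannian_metric M)
  (D : affine_connection M).
Local Notation A := (mfd_atlas M).
Local Notation TA := (tangent_atlas M).
Local Notation CA := (cotangent_atlas M).
Implicit Types (c : chart A) (p q : M) (z u v w : E * E) (x y a b : E).

Let fE : frame E := row_frame n.

Local Opaque tvec tcoord diff_transition diff_tangent_transition
  metric_in_chart.

(** If [D'] is the dual connection, with [X g(Y, Z) = g(D_X Y, Z) + g(Y, D'_X Z)], then on constant
    fields this is [g(y, D'_a b - D'_b a)]: the torsion of [D'] on [a] and [b], paired with [y]. *)
Definition defect_coef c a b x y : R :=
  metric_in_chart g c x a (christoffel_in_chart D c x b y) - metric_in_chart g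
    c x (christoffel_in_chart D c x a y) b -
  ('d (fun x => metric_in_chart g c x y a) x b - 'd (fun x =>
    metric_in_chart g c x y b) x a).

Let linear_sub (f h : E -> R) : linear f -> linear h ->
  linear (fun y => f y - h y : R).
Proof. by move=> lf lh k y y'; rewrite lf lh scalerBr opprD addrACA. Qed.

(** The derivative terms are linear in [y] by [diff_param_linear], which needs differentiability of
    the metric coefficients and hence [im c x]. *)
Lemma defect_coef_linear c a b x : im c x -> linear (defect_coef c a b x : E ->
  R).
Proof.
move=> cx.
have dl a' b' := diff_param_linear (fun x => metric_in_chart_linear_l g c x a')
  (fun y => metric_in_chart_smooth g c y a') b' cx.
have l1 : linear (fun y => metric_in_chart g c x a
  (christoffel_in_chart D c x b y) : R).
  by move=> k y y'; rewrite /christoffel_in_chart christoffel_form_linear_r;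
  exact: metric_in_chart_linear_r.
have l2 : linear (fun y => metric_in_chart g c x
  (christoffel_in_chart D c x a y) b : R).
  by move=> k y y'; rewrite /christoffel_in_chart christoffel_form_linear_r;
  exact: metric_in_chart_linear_l.
exact: linear_sub (linear_sub l1 l2) (linear_sub (dl a b) (dl b a)).
Qed.

Definition kahler_in_chart c z u v : R :=
  metric_in_chart g c z.1 u.1 (ver_in_chart D c z v) - metric_in_chart g c z.1
    (ver_in_chart D c z u) v.1.

Definition defect c z u v : R :=
  kahler_in_chart c z u v - canonical_in_chart g c z u v.

Lemma defect_smooth c u v :
  smooth_on [set z : E * E | im c z.1] (fun z => defect c z u v).
Proof.
have oT := open_fst (V' := E) (open_im c).
have sC (a : E) := @smooth_on_cst R _ _ [set z : E * E | im c z.1] a.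
apply: smooth_on_add => //; last by apply: smooth_on_opp => //;
exact: canonical_in_chart_smooth.
apply: smooth_on_add => //; last apply: smooth_on_opp => //.
  by apply: metric_in_chart_smooth_comp => //; exact: ver_in_chart_smooth.
by apply: metric_in_chart_smooth_comp => //; exact: ver_in_chart_smooth.
Qed.

Lemma defectE c z u v : im c z.1 ->
  defect c z u v = defect_coef c u.1 v.1 z.1 z.2.
Proof.
move=> cx.
have dN b w : 'd (liouville g c ^~ b) z w =
    'd (fun x => metric_in_chart g c x z.2 b)
      (z.1) w.1 + metric_in_chart g c z.1 w.2 b.
  exact: (diff_linear_param fE fE (open_im c) (fun x =>
    metric_in_chart_linear_l g c x b)
    (fun y => metric_in_chart_smooth g c y b) w cx).
apply: (etrans (congr1 (fun r : R => kahler_in_chart c z u v - r)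
  (congr2 (fun r s : R => r - s) (dN u.1 v) (dN v.1 u)))).
rewrite /kahler_in_chart /defect_coef /ver_in_chart; set x := z.1; set y := z.2.
have gD (w w' b : E) : metric_in_chart g c x
  (w + w') b = metric_in_chart g c x w b + metric_in_chart g c x w' b.
  by have := metric_in_chart_linear_l g c x b 1 w w'; rewrite !scale1r.
have gS (w w' : E) : metric_in_chart g c x w w' = metric_in_chart g c x w' w by
  exact: metric_sym.
(* Here [r] pairs [v.2] with [u.1] and [t] pairs [u.2] with [v.1]; each occurs once in either form
   and cancels. [s], [e] are the Christoffel terms and [d], [d'] the derivatives of the metric. *)
have alg (r s t e d d' : R) :
    (r + s) - (t + e) - (d + r - (d' + t)) = s - e - (d - d').
  have -> : r + s - (t + e) = s - e + (r - t) by rewrite opprD addrACA addrC.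
  have -> : d + r - (d' + t) = r - t + (d - d') by rewrite opprD addrACA addrC.
  exact: addrKA.
rewrite (gS u.1 (_ + _)) !gD (gS v.2) (gS (christoffel_in_chart D c x v.1 y)).
exact: alg.
Qed.

Lemma defect_coef_vert c a x y : defect_coef c a 0 x y = 0.
Proof.
have lin0 (W : lmodType R) (f : E -> W) : linear f -> f 0 = 0.
  by move=> /(_ (-1) 0 0); rewrite scaler0 addr0 scaleN1r addNr.
have G0 : christoffel_in_chart D c x 0 y = 0 by apply: lin0
  (christoffel_form_linear_l D c _ y).
have g0 x' X : metric_in_chart g c x' X 0 = 0 by apply: lin0
  (metric_in_chart_linear_r g c x' X).
have d0 : 'd (fun x => metric_in_chart g c x y 0) x a = 0.
  by rewrite (_ : (fun x => _) = fun _ => 0) ?diff_cstE//; apply/funext.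
have d0' : 'd (fun x => metric_in_chart g c x y a) x 0 = 0 by exact: linear0.
by rewrite /defect_coef G0 !g0 d0 d0' !subr0.
Qed.

Lemma defect_vert c z u y : im c z.1 -> defect c z u (0, y) = 0.
Proof. by move=> cx; rewrite defectE// defect_coef_vert. Qed.

Lemma defect_eq0 c p y u v :
  closed_form TA (kahler_form (nat_J D) (nat_metric g D)) -> dom A c p ->
  defect c (coord A c p, y) u v = 0.
Proof.
move=> clK cp; set z := (coord A c p, y); have zT : im c z.1 by exists p.
have zT' : im (A := TA) c z by rewrite im_tangent.
have dD (a b : E * E) := smooth_on_differentiable (defect_smooth c a b) zT.
have dP (a b : E * E) := smooth_on_differentiable
  (canonical_in_chart_smooth g c a b) zT.
(* The fibre coordinate [y] of [z] is frozen here while the point varies, because the formula for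
   the exterior derivative takes constant components. *)
pose w : E * E := (0, y).
have near_K (a b : E * E) : {near z,
    (fun t => defect c t a b) + (fun t =>
      canonical_in_chart g c t a b) =1 bilin_in_chart (A := TA)
    (kahler_form (nat_J D) (nat_metric g D)) c a b}.
  apply: (near_tangent _ (open_dom c) cp cp) => q y' cq _.
  by rewrite kahler_form_chart// fctE /defect subrK.
have dK (a b e : E * E) : 'd (bilin_in_chart (A := TA)
    (kahler_form (nat_J D) (nat_metric g D)) c a b) z e =
    'd (fun t => defect c t a b) z e + 'd (fun t =>
      canonical_in_chart g c t a b) z e.
  apply: (etrans (near_eq_diffE e (near_K a b) _)).
    exact: differentiableD.
  exact: (congr1 (fun h : E * E -> R => h e) (diffD (dD a b) (dP a b))).
have vert0 (a e : E * E) : 'd (fun t => defect c t a w) z e = 0.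
  apply: etrans (diff_cstE (0 : R) z e).
  apply: near_eq_diffE; last exact: differentiable_cst.
  apply: (near_tangent _ (open_dom c) cp cp) => q y' cq _.
  by rewrite defect_vert//; exists q.
have homog : 'd (fun t => defect c t u v) z w = defect c z u v.
  apply: (diff_homogeneous (dD u v)) => t.
  (* Moving from [z] along [w] only rescales the fibre coordinate, by [t + 1]. *)
  have -> : t *: w + z = (coord A c p, t *: y + y).
    apply: injective_projections; last by [].
    by rewrite -[LHS]/(t *: 0 + coord A c p) scaler0 add0r.
  rewrite !defectE//; apply: etrans (defect_coef_linear u.1 v.1 zT t y y) _.
  by rewrite mulrDl mul1r.
(* [d1], [d2], [d3] come from the defect and the [p]s from the canonical part, whose alternating sum
   vanishes by itself. With [d1] and [d2] zero by [vert0], only [d3] is left. *)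
have alg (d1 d2 d3 p1 p2 p3 : R) : (d1 + p1) - (d2 + p2) + (d3 + p3) = 0 ->
    p1 - p2 + p3 = 0 -> d1 = 0 -> d2 = 0 -> d3 = 0.
  move=> dE pE d1E d2E; move: dE.
  by rewrite d1E d2E !add0r addrCA pE addr0.
have := clK c z zT' u v w; rewrite /ext_deriv_in_chart.
move=> /(etrans (esym (congr2 +%R (congr2 (fun r s : R => r - s)
  (dK v w u) (dK u w v)) (dK u v w)))) E0.
apply: (etrans (esym homog)).
exact: alg E0 (canonical_in_chart_closed g u v w zT) (vert0 v u) (vert0 u v).
Qed.

Lemma kahler_eq_pullback :
  closed_form TA (kahler_form (nat_J D) (nat_metric g D)) ->
  kahler_form (nat_J D) (nat_metric g D) =
    pullback TA CA (flat g) (@canonical_symplectic R n M).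
Proof.
move=> clK; apply/funext => -[p v]; apply/funext => B; apply/funext => C.
have cp := dom_chart_at p; set c := chart_at A p in cp.
(* All vectors, and the point of the fibre, are expressed by their components in [c], so that the
   claim becomes the vanishing of the defect there. *)
have [B' ->] := tvec_tangent_surj p v B;
have [C' ->] := tvec_tangent_surj p v C.
have [y ->] : exists y, v = tvec c p y.
  by exists (tcoord c p v); rewrite tcoordK.
rewrite -(param_tangent y cp).
have E1 := defect_eq0 y B' C' clK cp.
have E2 := pullback_chart g y B' C' cp.
have E3 := kahler_form_chart g D y B' C' cp.
apply: etrans E3 _; apply: etrans _ (esym E2).
by apply/eqP; rewrite -subr_eq0; apply/eqP.
Qed.

End Main.

Theorem theorem3p1 (R : realType) (n : nat) (M : manifold R n)
    (g : riemannian_metric M) (D : affine_connection M) :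
  is_almost_kahler (tangent_atlas M) (nat_J D) (nat_metric g D) <->
  kahler_form (nat_J D) (nat_metric g D) =
    pullback (tangent_atlas M) (cotangent_atlas M) (flat g)
      (@canonical_symplectic R n M).
Proof.
split=> [[_]|E]; first exact: kahler_eq_pullback.
by split; [exact: nat_almost_hermitian|rewrite E; exact: pullback_closed].
Qed.
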